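(* The action of $G_2$ on the Grassmannian $Y=\mathrm{Gr}_4(\mathbb{R}^7)$ of non-oriented four-planes of $\mathbb{R}^7$ has cohomogeneity one with principal isotropy $\mathrm{SO}(3)$. There are exactly two special (i.e. non-principal) orbits; they are not equivalent as $G_2$-spaces, and have isotropy types $\mathrm{SO}(4)$ and $\mathrm{SO}(3)\times\mathbb{Z}_2$ respectively.
   Context: $G_2\subset\mathrm{SO}(7)$ is the stabiliser in $\mathrm{GL}(7,\mathbb{R})$ of the three-form $\varphi=\omega_1\wedge dr^1+\omega_2\wedge dr^2+\omega_3\wedge dr^3-dr^1\wedge dr^2\wedge dr^3$ on $\mathbb{R}^7$ with coordinates $(x^1,x^2,x^3,r^0,r^1,r^2,r^3)$, where $\omega_1=dr^0\wedge dx^1+dx^2\wedge dx^3$, $\omega_2=dr^0\wedge dx^2-dx^1\wedge dx^3$, $\omega_3=dr^0\wedge dx^3+dx^1\wedge dx^2$. It acts on $\mathrm{Gr}_4(\mathbb{R}^7)$ by $(g,\xi)\mapsto g(\xi)$. Isotropy (type) of an orbit is the stabiliser of a point on it, up to isomorphism. ''Cohomogeneity one'' means that principal orbits have codimension one. *)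

(* Defs.v *)
From HB Require Import structures.
From mathcomp Require Import all_boot all_order all_algebra.
From mathcomp Require Import all_classical all_reals all_analysis.
Set Implicit Arguments.
Unset Strict Implicit.
Unset Printing Implicit Defensive.
Import Order.TTheory GRing.Theory Num.Theory.
Import numFieldNormedType.Exports.
Local Open Scope classical_set_scope.
Local Open Scope ring_scope.

Section Smooth.
Context {R : realType} {V W : normedModType R}.

(* On a finite-dimensional V and an open U, f is of class C^r if and only if its
   iterated directional derivatives of order <= r exist and are continuous. *)
Fixpoint class_C (r : nat) (U : set V) (f : V -> W) : Prop :=
  (forall x, U x -> {for x, continuous f}) /\
  if r is s.+1 then
    forall v, (forall x, U x -> derivable f x v) /\
              class_C s U (fun x => 'D_v f x)
  else True.

Definition smooth_on_open (U : set V) (f : V -> W) : Prop :=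
  forall r, class_C r U f.

(* Smoothness on an arbitrary subset: local extendability to a smooth map. *)
Definition smooth_on (S : set V) (f : V -> W) : Prop :=
  forall x, S x -> exists U (F : V -> W),
    [/\ open U, U x, smooth_on_open U F & forall y, S y -> U y -> F y = f y].

End Smooth.

(* Near p, the set S is the common zero set of d real functions whose
   differentials at p are linearly independent (i.e. jointly surjective). *)
Definition submanifold_codim_at (R : realType) (V : normedModType R)
    (d : nat) (S : set V) (p : V) : Prop :=
  exists (U : set V) (f : 'I_d -> V -> R),
    [/\ open U, U p,
        forall i, smooth_on_open U (f i),
        forall y : 'I_d -> R, exists v : V, forall i, 'D_v (f i) p = y i
      & forall x, U x -> (S x <-> forall i, f i x = 0)].

Section Actions.
Context {R : realType} {n : nat} (G : set 'M[R]_n).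
Context {X : Type} (act : 'M[R]_n -> X -> X).

Definition orbit_of (x : X) : set X := [set act g x | g in G].

Definition stabiliser (x : X) : set 'M[R]_n := [set g | G g /\ act g x = x].

Definition orbits : set (set X) := [set orbit_of x | x in setT].

(* x lies on an orbit of the maximum orbit type: its stabiliser is
   subconjugate to every other stabiliser. *)
Definition principal_point (x : X) : Prop :=
  forall y, exists2 g, G g &
    forall h, stabiliser x h -> stabiliser y (g *m h *m invmx g).

Definition principal_orbits : set (set X) :=
  [set orbit_of x | x in principal_point].

Definition special_orbits : set (set X) := orbits `\` principal_orbits.

End Actions.

(* Equivalence as G-spaces of two invariant subspaces A of X and B of Y:
   existence of a G-equivariant homeomorphism. *)
Definition G_space_equiv (R : realType) (n : nat) (G : set 'M[R]_n)
    (X Y : topologicalType)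
    (actX : 'M[R]_n -> X -> X) (actY : 'M[R]_n -> Y -> Y)
    (A : set X) (B : set Y) : Prop :=
  exists (f : X -> Y) (f' : Y -> X),
    [/\ (forall x, A x -> B (f x) /\ f' (f x) = x),
        (forall y, B y -> A (f' y) /\ f (f' y) = y),
        {within A, continuous f}, {within B, continuous f'}
      & forall g x, G g -> A x -> f (actX g x) = actY g (f x)].

Section MatrixGroups.
Context {R : realType}.

Definition lie_group_iso (n m : nat) (G : set 'M[R]_n) (H : set 'M[R]_m) :
    Prop :=
  exists (f : 'M[R]_n -> 'M[R]_m) (f' : 'M[R]_m -> 'M[R]_n),
    [/\ (forall g, G g -> H (f g) /\ f' (f g) = g),
        (forall h, H h -> G (f' h) /\ f (f' h) = h),
        (forall g1 g2, G g1 -> G g2 -> f (g1 *m g2) = f g1 *m f g2),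
        smooth_on G f & smooth_on H f'].

Definition SO (n : nat) : set 'M[R]_n :=
  [set A | A *m A^T = 1%:M /\ \det A = 1].

Definition Z2 : set 'M[R]_1 := [set 1%:M; - 1%:M].

(* The direct product of two matrix groups, realised block-diagonally. *)
Definition mxgroup_prod (n m : nat) (G : set 'M[R]_n) (H : set 'M[R]_m) :
    set 'M[R]_(n + m) :=
  [set M | exists A B, [/\ G A, H B & M = block_mx A 0 0 B]].

End MatrixGroups.

Section Grassmannian.
Context {R : realType} (n k : nat).

Definition Gr := {U : {vspace 'cV[R]_n} | \dim U == k}.
HB.instance Definition _ := SubChoice.on Gr.

Definition colspan (m : nat) (B : 'M[R]_(n, m)) : {vspace 'cV[R]_n} :=
  limg (linfun (mulmx B : 'cV[R]_m -> 'cV[R]_n)).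

(* The quotient topology of the space of k-frames (full-rank n x k matrices,
   with the subspace topology) under B |-> colspan B. *)
Definition Gr_open (O : set Gr) : Prop :=
  forall (B : 'M[R]_(n, k)) (xi : Gr), colspan B = val xi -> O xi ->
    \forall C \near B, forall eta : Gr, colspan C = val eta -> O eta.

Lemma Gr_openT : Gr_open setT.
Proof. by move=> B xi _ _; near=> C. Unshelve. all: by end_near. Qed.

Lemma Gr_openI (A B : set Gr) : Gr_open A -> Gr_open B -> Gr_open (A `&` B).
Proof.
move=> oA oB M xi Mxi [Axi Bxi].
by apply: filterS2 (oA M xi Mxi Axi) (oB M xi Mxi Bxi) => C hA hB eta e;
  split; [exact: hA|exact: hB].
Qed.

Lemma Gr_open_bigU (I : Type) (A : I -> set Gr) :
  (forall i, Gr_open (A i)) -> Gr_open (\bigcup_i A i).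
Proof.
move=> oA M xi Mxi [i _ Axi].
by apply: filterS (oA i M xi Mxi Axi) => C h eta e; exists i => //; exact: h.
Qed.

HB.instance Definition _ :=
  isOpenTopological.Build Gr Gr_openT Gr_openI Gr_open_bigU.

(* For g not invertible, g @: xi need not have dimension k; the value is then
   the junk value xi whenever the dimension drops. *)
Definition Gr_act (g : 'M[R]_n) (xi : Gr) : Gr :=
  insubd xi (linfun (mulmx g : 'cV[R]_n -> 'cV[R]_n) @: val xi)%VS.

Lemma Gr_actE (g : 'M[R]_n) (xi : Gr) : g \in unitmx ->
  val (Gr_act g xi) =
  (linfun (mulmx g : 'cV[R]_n -> 'cV[R]_n) @: val xi)%VS.
Proof.
move=> gU; rewrite val_insubd limg_dim_eq ?(valP xi) //.
suff -> : lker (linfun (mulmx g : 'cV[R]_n -> 'cV[R]_n)) = 0%VS by rewrite capv0.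
apply/eqP/lker0P => u v; rewrite !lfunE /= => /(congr1 (mulmx (invmx g))).
by rewrite !mulKmx.
Qed.

(* The standard affine chart A |-> colspan (B + C A) of the Grassmannian
   attached to complementary frames B and C. *)
Definition chart_preimage (B : 'M[R]_(n, k)) (C : 'M[R]_(n, n - k))
    (S : set Gr) : set 'M[R]_(n - k, k) :=
  [set A | exists2 xi, S xi & val xi = colspan (B + C *m A)].

(* S is an embedded submanifold of codimension d, tested in standard charts
   centred at the points of S. *)
Definition Gr_submanifold_codim (d : nat) (S : set Gr) : Prop :=
  forall xi, S xi ->
    exists (B : 'M[R]_(n, k)) (C : 'M[R]_(n, n - k)),
      [/\ val xi = colspan B, row_free (row_mx B C)
        & submanifold_codim_at d (chart_preimage B C S) 0].

End Grassmannian.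

Section G2.
Context {R : realType}.
Implicit Types u v w : 'cV[R]_7.

Definition wedge11 (a b : 'cV[R]_7 -> R) : 'cV[R]_7 -> 'cV[R]_7 -> R :=
  fun u v => a u * b v - a v * b u.

Definition wedge21 (omega : 'cV[R]_7 -> 'cV[R]_7 -> R) (a : 'cV[R]_7 -> R) :
    'cV[R]_7 -> 'cV[R]_7 -> 'cV[R]_7 -> R :=
  fun u v w => omega u v * a w + omega v w * a u + omega w u * a v.

(* The coordinates are (x^1, x^2, x^3, r^0, r^1, r^2, r^3), in this order. *)
Definition dx (i : nat) v : R := v (inord i.-1) 0.
Definition dr (i : nat) v : R := v (inord (3 + i)) 0.

Definition omega1 u v := wedge11 (dr 0) (dx 1) u v + wedge11 (dx 2) (dx 3) u v.
Definition omega2 u v := wedge11 (dr 0) (dx 2) u v - wedge11 (dx 1) (dx 3) u v.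
Definition omega3 u v := wedge11 (dr 0) (dx 3) u v + wedge11 (dx 1) (dx 2) u v.

Definition phi u v w : R :=
  wedge21 omega1 (dr 1) u v w + wedge21 omega2 (dr 2) u v w
  + wedge21 omega3 (dr 3) u v w
  - wedge21 (wedge11 (dr 1) (dr 2)) (dr 3) u v w.

Definition G2 : set 'M[R]_7 :=
  [set g | g \in unitmx /\
    forall u v w, phi (g *m u) (g *m v) (g *m w) = phi u v w].

End G2.

(* Main.v *)
Require Import Defs.
From mathcomp Require Import all_boot all_order all_algebra.
From mathcomp Require Import all_classical all_reals all_analysis.
From mathcomp Require Import ring lra.

(** A four-plane of R^7 is determined by its normal three-space, and on an
    orthonormal frame N of that space the number phi3 N, the value of the
    three-form on the three columns, is defined up to sign. Two facts make its
    square a complete invariant. First, G2 consists of isometries of R^7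
    ([G2_tr_mul]): the metric can be read off the degenerate skew forms
    phi u v w obtained by fixing u. Second, G2 is transitive on
    orthonormal triples with a given value of phi ([G2_triple_transitive]): any
    orthonormal triple on which phi vanishes generates, under the cross product,
    a basis with the same multiplication table as the standard one
    ([adapted_frame_G2]), and every other triple is a fixed combination of the
    vectors of such a basis. Hence orbits are the level sets of a function with
    values in the interval from 0 to 1 ([same_orbitP]).

    To find the isotropy groups, view R^7 as C^3 plus a line, with z = r + i x
    and r_0 on the line. Then phi is r_0 times the Kaehler form minus the real
    part of the complex volume form, and a real orthogonal matrix A of
    determinant 1, acting on the x and r blocks simultaneously, lies in G2. The
    normal spaces (a + i b) R^3 with a^2 + b^2 = 1 are stable under all these A,
    and phi takes on them the value minus the real part of (a + i b)^3, so they
    meet every orbit ([model_exhaustive]). Write c for that value.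

    If c is neither 0 nor 1 nor -1, an element of G2 that fixes the frame
    pointwise fixes a basis, and the isotropy is exactly this copy of SO(3)
    ([generic_stab]). It is the same subgroup for all generic planes of the
    family and is contained in the stabiliser of every plane of the family, so
    generic planes are principal ([generic_principal]). If c = 0, orthogonal A
    of determinant -1 also occur, and the isotropy is O(3), that is
    SO(3) x Z_2 ([null_isotropy]). If c^2 = 1, the plane is coassociative and an
    element of its stabiliser is determined by its restriction to the plane,
    which can be any element of SO(4) ([coassoc_isotropy]). In the last two
    cases the isotropy contains matrices with no common nonzero fixed vector,
    whereas the generic isotropy fixes r_0; so these orbits are not principal
    ([diag_not_principal]).

    A generic orbit is a hypersurface because c^2 has nonzero derivative along
    the rotation of a + i b ([orbit_codim1]). The two special orbits are not
    equivalent because the isotropy SO(4) of a coassociative plane is transitive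
    on the directions of the plane, so it stabilises no other four-plane
    ([coassoc_only_invariant]). *)

Set Implicit Arguments.
Unset Strict Implicit.
Unset Printing Implicit Defensive.
Import Order.TTheory GRing.Theory Num.Theory.
Import numFieldNormedType.Exports.
Local Open Scope classical_set_scope.
Local Open Scope ring_scope.

(** * Polynomial maps are smooth *)

Section PolynomialMaps.
Context {R : realType} {m n : nat}.

(** Polynomial functions of the entries, closed under sums and products by
    construction; directional derivatives stay in the class, which is what the
    iterated definition of smoothness asks for. *)
Inductive polyfun : ('M[R]_(m, n) -> R) -> Prop :=
| polyfun_cst c : polyfun (fun=> c)
| polyfun_coord i j : polyfun (fun x => x i j)
| polyfunD f g : polyfun f -> polyfun g -> polyfun (fun x => f x + g x)
| polyfunM f g : polyfun f -> polyfun g -> polyfun (fun x => f x * g x).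

Lemma polyfun_continuous f : polyfun f -> continuous f.
Proof.
elim=> [c|i j|{}f g _ cf _ cg|{}f g _ cf _ cg] x.
- exact: cst_continuous.
- exact: coord_continuous.
- exact: (cvgD (cf x) (cg x)).
- exact: (cvgM (cf x) (cg x)).
Qed.

Lemma is_derive_coord i j (x v : 'M[R]_(m, n)) :
  is_derive x v (fun y : 'M[R]_(m, n) => y i j) (v i j).
Proof.
have e : (fun h : R => h^-1 *: ((h *: v + x) i j - x i j)) @ 0^' --> v i j.
  apply: (@cvg_trans _ ((fun=> v i j) @ (0 : R)^')); last exact: cvg_cst.
  apply: near_eq_cvg; near=> h.
  rewrite !mxE addrK scalerA mulVf ?scale1r //.
  by near: h; exact: nbhs_dnbhs_neq.
by apply: DeriveDef; [apply/cvg_ex; exists (v i j)|exact: cvg_lim].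
Unshelve. all: by end_near. Qed.

Lemma polyfun_derive f : polyfun f -> forall v,
  (forall x, derivable f x v) /\ polyfun (fun x => 'D_v f x).
Proof.
elim=> [c|i j|{}f g pf IHf pg IHg|{}f g pf IHf pg IHg] v.
- split=> [x|]; first exact: derivable_cst.
  suff -> : (fun x => 'D_v (fun=> c) x) = (fun=> 0) :> ('M[R]_(m, n) -> R).
    exact: polyfun_cst.
  by apply/funext => x; rewrite derive_cst.
- split=> [x|]; first exact: (@ex_derive _ _ _ _ _ _ _ (is_derive_coord i j x v)).
  suff -> : (fun x => 'D_v (fun y : 'M[R]_(m, n) => y i j) x) = (fun=> v i j).
    exact: polyfun_cst.
  by apply/funext => x; rewrite (derive_val (is_derive := is_derive_coord i j x v)).
- have [[df pdf] [dg pdg]] := (IHf v, IHg v).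
  split=> [x|]; first exact: derivableD.
  suff -> : (fun x => 'D_v (fun y => f y + g y) x) = (fun x => 'D_v f x + 'D_v g x).
    exact: polyfunD.
  by apply/funext => x; rewrite deriveD.
- have [[df pdf] [dg pdg]] := (IHf v, IHg v).
  split=> [x|]; first exact: derivableM.
  suff -> : (fun x => 'D_v (fun y => f y * g y) x) =
      (fun x => f x * 'D_v g x + g x * 'D_v f x).
    by apply: polyfunD; exact: polyfunM.
  by apply/funext => x; rewrite deriveM.
Qed.

Lemma polyfun_smooth f : polyfun f -> smooth_on_open setT f.
Proof.
move=> pf r; elim: r f pf => [|r IHr] f pf /=.
  by split=> // x _; exact: polyfun_continuous.
split=> [x _|v]; first exact: polyfun_continuous.
have [df pdf] := polyfun_derive pf v.
by split=> [x _|]; [exact: df|exact: IHr].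
Qed.

Lemma polyfun_sum (I : Type) (s : seq I) (P : pred I) (F : I -> 'M[R]_(m, n) -> R) :
  (forall i, polyfun (F i)) -> polyfun (fun x => \sum_(i <- s | P i) F i x).
Proof.
move=> pF; elim: s => [|i s IHs].
  by under eq_fun do rewrite big_nil; exact: polyfun_cst.
under eq_fun do rewrite big_cons.
by case: (P i) => //; exact: polyfunD.
Qed.

Lemma polyfun_prod (I : Type) (s : seq I) (P : pred I) (F : I -> 'M[R]_(m, n) -> R) :
  (forall i, polyfun (F i)) -> polyfun (fun x => \prod_(i <- s | P i) F i x).
Proof.
move=> pF; elim: s => [|i s IHs].
  by under eq_fun do rewrite big_nil; exact: polyfun_cst.
under eq_fun do rewrite big_cons.
by case: (P i) => //; exact: polyfunM.
Qed.

Definition polymap p q (F : 'M[R]_(m, n) -> 'M[R]_(p, q)) :=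
  forall i j, polyfun (fun x => F x i j).

(** The norm of a matrix is the largest modulus of its entries, so entrywise
    estimates suffice. *)
Lemma polymap_continuous p q (F : 'M[R]_(m, n) -> 'M[R]_(p, q)) :
  polymap F -> continuous F.
Proof.
move=> pF x; apply/(@cvgrPdist_le _ _ _ (nbhs x) (nbhs_filter x) F (F x)) => /= e e0.
have near_coord (k : 'I_p * 'I_q) :
    \forall y \near nbhs x, `|F x k.1 k.2 - F y k.1 k.2| <= e.
  by have /cvgrPdist_le /(_ _ e0) := polyfun_continuous (pF k.1 k.2) (x := x).
have := @filter_forall _ _ _ (nbhs x) (nbhs_filter x) near_coord.
apply: (@filterS _ (nbhs x) (nbhs_filter x)) => y Fy.
by rewrite /Num.Def.normr/= mx_normrE (bigmax_le _ (ltW e0))//= => k _; rewrite !mxE.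
Qed.

Lemma polymap_smooth p q (F : 'M[R]_(m, n) -> 'M[R]_(p, q)) :
  polymap F -> smooth_on_open setT F.
Proof.
move=> pF r; elim: r F pF => [|r IHr] F pF /=.
  by split=> // x _; exact: polymap_continuous.
split=> [x _|v]; first exact: polymap_continuous.
split=> [x _|].
  by apply/derivable_mxP => i j; have [] := polyfun_derive (pF i j) v.
apply: IHr => i j.
suff -> : (fun x => ('D_v F x) i j) = (fun x => 'D_v (fun t => F t i j) x).
  by have [] := polyfun_derive (pF i j) v.
apply/funext => x; rewrite derive_mx ?mxE //.
by apply/derivable_mxP => k l; have [] := polyfun_derive (pF k l) v.
Qed.

Lemma polymap_smooth_on p q (F : 'M[R]_(m, n) -> 'M[R]_(p, q)) S :
  polymap F -> smooth_on S F.
Proof.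
by move=> pF x _; exists setT, F; split=> //; [exact: openT|exact: polymap_smooth].
Qed.

Lemma polymap_cst p q (A : 'M[R]_(p, q)) : polymap (fun=> A).
Proof. by move=> i j; exact: polyfun_cst. Qed.

Lemma polymap_id : polymap id.
Proof. by move=> i j; exact: polyfun_coord. Qed.

Lemma polymap_mul p q r (F : 'M[R]_(m, n) -> 'M[R]_(p, q))
    (G : 'M[R]_(m, n) -> 'M[R]_(q, r)) :
  polymap F -> polymap G -> polymap (fun x => F x *m G x).
Proof.
move=> pF pG i j; under eq_fun do rewrite mxE.
by apply: polyfun_sum => k; exact: polyfunM.
Qed.

Lemma polymap_scale p q (f : 'M[R]_(m, n) -> R) (G : 'M[R]_(m, n) -> 'M[R]_(p, q)) :
  polyfun f -> polymap G -> polymap (fun x => f x *: G x).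
Proof. by move=> pf pG i j; under eq_fun do rewrite mxE; exact: polyfunM. Qed.

Lemma polymap_add p q (F G : 'M[R]_(m, n) -> 'M[R]_(p, q)) :
  polymap F -> polymap G -> polymap (fun x => F x + G x).
Proof. by move=> pf pG i j; under eq_fun do rewrite mxE; exact: polyfunD. Qed.

Lemma polymap_opp p q (F : 'M[R]_(m, n) -> 'M[R]_(p, q)) :
  polymap F -> polymap (fun x => - F x).
Proof.
move=> pF i j; under eq_fun do rewrite mxE -mulN1r.
by apply: polyfunM => //; exact: polyfun_cst.
Qed.

Lemma polymap_tr p q (F : 'M[R]_(m, n) -> 'M[R]_(p, q)) :
  polymap F -> polymap (fun x => (F x)^T).
Proof. by move=> pf i j; under eq_fun do rewrite mxE. Qed.

Lemma polyfun_det p (F : 'M[R]_(m, n) -> 'M[R]_p) :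
  polymap F -> polyfun (fun x => \det (F x)).
Proof.
move=> pF; apply: polyfun_sum => s; apply: polyfunM; first exact: polyfun_cst.
exact: polyfun_prod.
Qed.

Lemma polymap_block p q r s (F : 'M[R]_(m, n) -> 'M[R]_(p, q))
    (G : 'M[R]_(m, n) -> 'M[R]_(p, r)) (H : 'M[R]_(m, n) -> 'M[R]_(s, q))
    (K : 'M[R]_(m, n) -> 'M[R]_(s, r)) :
  polymap F -> polymap G -> polymap H -> polymap K ->
  polymap (fun x => block_mx (F x) (G x) (H x) (K x)).
Proof.
move=> pF pG pH pK i j.
case: (split_ordP i) => k ->; case: (split_ordP j) => l ->.
- by under eq_fun do rewrite block_mxEul.
- by under eq_fun do rewrite block_mxEur.
- by under eq_fun do rewrite block_mxEdl.
- by under eq_fun do rewrite block_mxEdr.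
Qed.

End PolynomialMaps.

Lemma polyfun_comp (R : realType) m n p q (f : 'M[R]_(p, q) -> R)
    (F : 'M[R]_(m, n) -> 'M[R]_(p, q)) :
  polyfun f -> polymap F -> polyfun (fun x => f (F x)).
Proof.
move=> pf pF; elim: pf => [c|i j|{}f g _ pf _ pg|{}f g _ pf _ pg].
- exact: polyfun_cst.
- exact: pF.
- exact: polyfunD.
- exact: polyfunM.
Qed.

Lemma polymap_comp (R : realType) m n p q r s (F : 'M[R]_(p, q) -> 'M[R]_(r, s))
    (G : 'M[R]_(m, n) -> 'M[R]_(p, q)) :
  polymap F -> polymap G -> polymap (fun x => F (G x)).
Proof. by move=> pF pG i j; exact: (polyfun_comp (pF i j)). Qed.

(** * The cross product of the three-form *)

Section Cross.
Context {R : realType}.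
Implicit Types u v w : 'cV[R]_7.

Definition o7 (k : nat) : 'I_7 := inord k.

Lemma ord7P (P : 'I_7 -> Prop) :
  P (o7 0) -> P (o7 1) -> P (o7 2) -> P (o7 3) -> P (o7 4) -> P (o7 5) ->
  P (o7 6) -> forall i, P i.
Proof.
move=> h0 h1 h2 h3 h4 h5 h6 i; rewrite -(inord_val i).
by case: i; do 7?[case=> //].
Qed.

Lemma sum_inord (V : nmodType) n (F : 'I_n.+1 -> V) :
  \sum_i F i = \sum_(0 <= k < n.+1) F (inord k).
Proof.
rewrite (eq_bigr (fun i : 'I_n.+1 => F (inord i))); last by move=> i _; rewrite inord_val.
by rewrite -(big_mkord xpredT (fun i => F (inord i))).
Qed.

Lemma sum7 (V : nmodType) (F : 'I_7 -> V) :
  \sum_i F i = F (o7 0) + F (o7 1) + F (o7 2) + F (o7 3) + F (o7 4)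
    + F (o7 5) + F (o7 6).
Proof.
by rewrite sum_inord !big_nat_recr //= big_nil add0r.
Qed.

Definition col7 (s : seq R) : 'cV[R]_7 := \col_i s`_i.

Lemma col7E s k : (k < 7)%N -> col7 s (o7 k) 0 = s`_k.
Proof. by move=> hk; rewrite mxE inordK. Qed.

Lemma eq_col7 u v : (forall i, u i 0 = v i 0) -> u = v.
Proof. by move=> e; apply/matrixP => i j; rewrite (ord1 j) e. Qed.

Definition dotp u v : R := \sum_i u i 0 * v i 0.

(** With the coordinates x^1, x^2, x^3, r^0, r^1, r^2, r^3 numbered from 0 to 6, the
    oriented triples i, j, k such that e_i x e_j = e_k are 304, 315, 326, 124, 205,
    016 and 546; they are the seven terms of phi. *)
Definition cross u v : 'cV[R]_7 :=
  let m i j := u (o7 i) 0 * v (o7 j) 0 - u (o7 j) 0 * v (o7 i) 0 in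
  col7 [:: m 4 3 + m 5 2 + m 1 6; m 5 3 + m 2 4 + m 6 0;
    m 6 3 + m 4 1 + m 0 5; m 0 4 + m 1 5 + m 2 6;
    m 3 0 + m 1 2 + m 6 5; m 3 1 + m 2 0 + m 4 6; m 3 2 + m 0 1 + m 5 4].

Lemma phi_cross u v w : phi u v w = dotp (cross u v) w.
Proof.
rewrite /dotp sum7 !col7E //=.
rewrite /phi /wedge21 /omega1 /omega2 /omega3 /wedge11 /dx /dr /= -!/(o7 _).
ring.
Qed.

(** Off the line of u, multiplication by u squares to - |u|^2. Everything else about
    the cross product is derived from this and from the symmetries of phi. *)
Lemma crossK u v : cross u (cross u v) = dotp u v *: u - dotp u u *: v.
Proof.
apply: eq_col7; apply: ord7P; rewrite [LHS]col7E //= !mxE !inordK //= /dotp !sum7; ring.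
Qed.

End Cross.

Section Orthogonal.
Context {R : realType}.
Implicit Types u v w : 'cV[R]_7.

Lemma dotpE u v : dotp u v = (u^T *m v) 0 0.
Proof. by rewrite mxE; apply: eq_bigr => i _; rewrite mxE. Qed.

Lemma dotpC u v : dotp u v = dotp v u.
Proof. by apply: eq_bigr => i _; rewrite mulrC. Qed.

Lemma dotpDl u v w : dotp (u + v) w = dotp u w + dotp v w.
Proof. by rewrite -big_split; apply: eq_bigr => i _; rewrite mxE mulrDl. Qed.

Lemma dotpZl c u v : dotp (c *: u) v = c * dotp u v.
Proof. by rewrite mulr_sumr; apply: eq_bigr => i _; rewrite mxE mulrA. Qed.

Lemma dotpDr u v w : dotp u (v + w) = dotp u v + dotp u w.
Proof. by rewrite dotpC dotpDl !(dotpC u). Qed.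

Lemma dotpZr c u v : dotp u (c *: v) = c * dotp u v.
Proof. by rewrite dotpC dotpZl dotpC. Qed.

Lemma dotpNl u v : dotp (- u) v = - dotp u v.
Proof. by rewrite -scaleN1r dotpZl mulN1r. Qed.

Lemma dotpNr u v : dotp u (- v) = - dotp u v.
Proof. by rewrite -scaleN1r dotpZr mulN1r. Qed.

Lemma dotp_ge0 u : 0 <= dotp u u.
Proof. by apply: sumr_ge0 => i _; rewrite -expr2 sqr_ge0. Qed.

Lemma dotp_eq0 u : dotp u u = 0 -> u = 0.
Proof.
move=> e; apply: eq_col7 => i; rewrite mxE; apply/eqP.
rewrite -sqrf_eq0 expr2; apply/eqP; move: i isT; apply/psumr_eq0P => // i _.
by rewrite -expr2 sqr_ge0.
Qed.

Lemma crossC u v : cross v u = - cross u v.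
Proof.
by apply: eq_col7; apply: ord7P; rewrite [LHS]col7E //= !mxE !inordK //=; ring.
Qed.

Lemma crossDr u v w : cross u (v + w) = cross u v + cross u w.
Proof.
by apply: eq_col7; apply: ord7P; rewrite [LHS]col7E //= !mxE !inordK //=; ring.
Qed.

Lemma crossZr c u v : cross u (c *: v) = c *: cross u v.
Proof.
by apply: eq_col7; apply: ord7P; rewrite [LHS]col7E //= !mxE !inordK //=; ring.
Qed.

End Orthogonal.

(** * G2 preserves the Euclidean metric *)

Section G2Orthogonal.
Context {R : realType}.
Implicit Types u v w : 'cV[R]_7.

(** Both sides are the determinant of the block matrix with rows (1, u) and
    (- w^T, 1), computed by eliminating either block. *)
Lemma det_1D_rank1 n (u w : 'cV[R]_n) :
  \det (1%:M + u *m w^T) = 1 + (w^T *m u) 0 0.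
Proof.
pose L : 'M[R]_(n + 1) := block_mx 1%:M 0 w^T 1%:M.
pose L' : 'M[R]_(n + 1) := block_mx 1%:M 0 (- w^T) 1%:M.
pose X : 'M[R]_(n + 1) := block_mx (1%:M + u *m w^T) u 0 1%:M.
have XL : X *m L' = block_mx 1%:M u (- w^T) 1%:M.
  by rewrite mulmx_block !(mul1mx, mulmx1, mul0mx, mulmx0, addr0, add0r, mulmxN) addrK.
have e : L *m (X *m L') = block_mx 1%:M u 0 (1%:M + w^T *m u).
  rewrite XL mulmx_block !(mul1mx, mulmx1, mul0mx, mulmx0, addr0, add0r) subrr.
  by rewrite [w^T *m u + _]addrC.
have := congr1 determinant e.
rewrite !det_mulmx !det_ublock !det_lblock !det1 !mul1r !mulr1 => ->.
by rewrite det_mx11 !mxE.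
Qed.

Definition crossmx u : 'M[R]_7 := \matrix_(i, j) cross u (delta_mx j 0) i 0.

Lemma cross_sum u (I : Type) (s : seq I) (P : pred I) (F : I -> 'cV[R]_7) :
  cross u (\sum_(i <- s | P i) F i) = \sum_(i <- s | P i) cross u (F i).
Proof.
apply: (big_morph (cross u) (crossDr u)).
by have := crossZr 0 u 0; rewrite !scale0r.
Qed.

Lemma crossmxE u v : crossmx u *m v = cross u v.
Proof.
apply: eq_col7 => i; rewrite mxE.
have vE : v = \sum_j v j 0 *: delta_mx j 0.
  apply: eq_col7 => k; rewrite summxE (bigD1 k) //= big1 ?addr0.
    by rewrite !mxE !eqxx mulr1.
  by move=> j jk; rewrite !mxE eq_sym (negbTE jk) mulr0.
rewrite [in RHS]vE cross_sum summxE; apply: eq_bigr => j _.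
by rewrite crossZr !mxE mulrC.
Qed.

Lemma eq_mulmx_cV p (A B : 'M[R]_(p, 7)) : (forall v, A *m v = B *m v) -> A = B.
Proof.
move=> e; apply/matrixP => i j.
by have /matrixP/(_ i 0) := e (delta_mx j 0); rewrite -!colE !mxE.
Qed.

Lemma eq_dotp u v : (forall w, dotp u w = dotp v w) -> u = v.
Proof.
move=> e; apply: eq_col7 => i; have := e (delta_mx i 0).
have dE x : dotp x (delta_mx i 0) = x i 0; last by rewrite !dE.
rewrite /dotp (bigD1 i) //= big1 ?addr0; first by rewrite !mxE !eqxx mulr1.
by move=> j /negbTE ji; rewrite !mxE ji mulr0.
Qed.

Lemma dotp_mul (g : 'M[R]_7) u v : dotp (g *m u) v = dotp u (g^T *m v).
Proof. by rewrite !dotpE trmx_mul mulmxA. Qed.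

Lemma dotp_cross_anti u v w : dotp (cross u v) w = - dotp v (cross u w).
Proof. by rewrite /dotp !sum7 !col7E //=; ring. Qed.

Lemma crossmx_tr u : (crossmx u)^T = - crossmx u.
Proof.
apply: eq_mulmx_cV => v; apply: eq_dotp => w.
by rewrite dotp_mul trmxK mulNmx dotpNl !crossmxE dotp_cross_anti opprK.
Qed.

Lemma crossmx_id u : crossmx u *m u = 0.
Proof.
rewrite crossmxE; apply: eq_col7; apply: ord7P; rewrite [LHS]col7E // mxE /=; ring.
Qed.

Lemma crossmx_sq u : crossmx u *m crossmx u = u *m u^T - (dotp u u)%:M.
Proof.
apply: eq_mulmx_cV => v; rewrite -mulmxA !crossmxE crossK mulmxBl mul_scalar_mx.
congr (_ - _); rewrite -mulmxA; apply: eq_col7 => i.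
by rewrite !mxE big_ord1 -dotpE mulrC.
Qed.

(** The invariance of phi, with one argument fixed and the two others read as a
    bilinear form. *)
Lemma crossmx_G2 g u : G2 g -> g^T *m crossmx (g *m u) *m g = crossmx u.
Proof.
move=> [_ gphi]; apply: eq_mulmx_cV => v; apply: eq_dotp => w.
by rewrite -!mulmxA dotp_mul trmxK !crossmxE -!phi_cross gphi.
Qed.

(** The square of crossmx u is - |u|^2 on the orthogonal of u and 0 on u, so the
    matrix times its transpose is a scalar plus a rank one matrix. *)
Lemma det_crossmxD_self s u : dotp u u != 0 ->
  \det (crossmx u + s *: (u *m u^T)) ^+ 2 = s ^+ 2 * dotp u u ^+ 8.
Proof.
move=> q0; set q := dotp u u in q0 *.
have uu : u^T *m u = q%:M by rewrite [LHS]mx11_scalar -dotpE.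
have e : (crossmx u + s *: (u *m u^T)) *m (crossmx u + s *: (u *m u^T))^T
    = q *: (1%:M + (((s ^+ 2 * q - 1) / q) *: u) *m u^T).
  rewrite linearD linearZ /= trmx_mul trmxK crossmx_tr mulmxDl !mulmxDr.
  rewrite !mulmxN crossmx_sq -!scalemxAr -!scalemxAl !mulmxA crossmx_id.
  rewrite -[u *m u^T *m crossmx u]mulmxA.
  have -> : u^T *m crossmx u = 0.
    by apply: trmx_inj; rewrite trmx_mul crossmx_tr trmxK mulNmx crossmx_id oppr0 trmx0.
  rewrite mulmx0 mul0mx !scaler0 -[u *m u^T *m u]mulmxA uu mul_mx_scalar.
  rewrite -scalemxAl -/q.
  move: (u *m u^T) => U; apply/matrixP => i j; rewrite !mxE.
  by case: (i == j); rewrite ?mulr1n ?mulr0n; field.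
have := congr1 determinant e; rewrite det_mulmx det_tr -expr2 => ->.
by rewrite detZ det_1D_rank1 -scalemxAr uu !mxE eqxx mulr1n; field.
Qed.

(** A unimodular change of basis that moves u to a multiple of v preserves the
    skew form crossmx u, whose kernel is spanned by u; it reduces the
    computation to the case v = u. So the length of u is determined by the skew
    form and the volume form. *)
Lemma det_crossmxD u v : dotp u u != 0 -> dotp v u != 0 ->
  \det (crossmx u + v *m v^T) ^+ 2 = dotp v u ^+ 4 * dotp u u ^+ 4.
Proof.
move=> q0 t0; set q := dotp u u in q0 *; set t := dotp v u in t0 *.
pose k := q / t; pose w := q^-1 *: (k *: v - u).
have uu : u^T *m u = q%:M by rewrite [LHS]mx11_scalar -dotpE.
have vu : v^T *m u = t%:M by rewrite [LHS]mx11_scalar -dotpE.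
have wu : w^T *m u = 0.
  rewrite !linearZ linearB linearZ /= -scalemxAl mulmxBl -scalemxAl uu vu.
  by rewrite scale_scalar_mx divfK // subrr scaler0.
have Pu : (1%:M + w *m u^T) *m u = k *: v.
  rewrite mulmxDl mul1mx -mulmxA uu mul_mx_scalar scalerA divff // scale1r.
  by rewrite addrC subrK.
have uP : u^T *m (1%:M + u *m w^T) = k *: v^T.
  rewrite -trmx1 -[u in X in _ *m (_ + X *m _)]trmxK -trmx_mul -linearD -trmx_mul.
  by rewrite Pu linearZ.
have kC : crossmx u *m u = 0 := crossmx_id u.
have Ck : u^T *m crossmx u = 0.
  by apply: trmx_inj; rewrite trmx_mul crossmx_tr trmxK mulNmx kC oppr0 trmx0.
(* the factor 1 + w u^T has determinant 1 because w is orthogonal to u *)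
have e : (1%:M + w *m u^T) *m (crossmx u + k ^- 2 *: (u *m u^T))
    *m (1%:M + u *m w^T) = crossmx u + v *m v^T.
  have PC : (1%:M + w *m u^T) *m crossmx u = crossmx u.
    by rewrite mulmxDl mul1mx -mulmxA Ck mulmx0 addr0.
  have CQ : crossmx u *m (1%:M + u *m w^T) = crossmx u.
    by rewrite mulmxDr mulmx1 mulmxA kC mul0mx addr0.
  move: (1%:M + w *m u^T) (1%:M + u *m w^T) Pu uP PC CQ => P Q Pu uP PC CQ.
  rewrite mulmxDr mulmxDl PC CQ -scalemxAr -scalemxAl mulmxA Pu -mulmxA uP.
  have k0 : k != 0 by rewrite mulf_neq0 // invr_neq0.
  rewrite -scalemxAl -scalemxAr !scalerA (_ : k ^- 2 * k * k = 1) ?scale1r //.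
  by field.
rewrite -e !det_mulmx -[1%:M + w *m u^T]trmxK det_tr linearD /= trmx1 trmx_mul.
rewrite trmxK det_1D_rank1 wu mxE addr0 mul1r mulr1 det_crossmxD_self // -/q.
rewrite /k; field.
by rewrite q0 t0.
Qed.

Lemma dotp_gt0 u : u != 0 -> 0 < dotp u u.
Proof.
move=> u0; rewrite lt_neqAle dotp_ge0 andbT eq_sym.
by apply: contra u0 => /eqP /dotp_eq0 ->.
Qed.

(** Adding to the skew form of g u the square of the linear form dual to g u and
    pulling back by g gives the skew form of u plus the square of the form dual to
    g^T g u. Comparing the determinants of both sides relates |g u| to |u|. *)
Lemma G2_conformal g u : G2 g -> `|\det g| * dotp (g *m u) (g *m u) = dotp u u.
Proof.
move=> Gg; have [-> | u0] := eqVneq u 0.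
  by rewrite mulmx0 /dotp !big1 ?mulr0 // => i _; rewrite !mxE mul0r.
have gu0 : g *m u != 0.
  apply: contra u0 => /eqP gu; have [gU _] := Gg.
  by rewrite -[u](mulKmx gU) gu mulmx0.
have := dotp_gt0 u0; have := dotp_gt0 gu0.
set t := dotp (g *m u) _; set q := dotp u u => t_gt0 q_gt0.
have e : g^T *m (crossmx (g *m u) + (g *m u) *m (g *m u)^T) *m g
    = crossmx u + (g^T *m (g *m u)) *m (g^T *m (g *m u))^T.
  by rewrite mulmxDr mulmxDl crossmx_G2 // [(g^T *m _)^T]trmx_mul trmxK !mulmxA.
have := congr1 (fun A => \det A ^+ 2) e.
have tE : dotp (g^T *m (g *m u)) u = t by rewrite dotp_mul trmxK.
rewrite det_crossmxD ?tE ?gt_eqF // !det_mulmx det_tr !exprMn.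
rewrite -[(g *m u) *m _]scale1r det_crossmxD_self ?gt_eqF // -/t -/q => h.
have dt_ge0 : 0 <= `|\det g| * t by rewrite mulr_ge0 ?(ltW t_gt0).
apply/eqP; rewrite -(@eqrXn2 _ 4) ?(ltW q_gt0) //; apply/eqP.
have -> : (`|\det g| * t) ^+ 4 = \det g ^+ 4 * t ^+ 4.
  by rewrite exprMn -[4%N]/(2 * 2)%N [`|_| ^+ _]exprM [\det g ^+ _]exprM real_normK ?num_real.
by apply: (@mulIf _ (t ^+ 4)); [rewrite gt_eqF ?exprn_gt0|ring: h].
Qed.

(** An element of G2 multiplies the metric by d^-1, where d is the modulus of its
    determinant. Taking determinants of this relation gives d^9 = 1. *)
Lemma G2_tr_mul (g : 'M[R]_7) : G2 g -> g^T *m g = 1%:M.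
Proof.
move=> Gg; set d := `|\det g|.
have d_ge0 : 0 <= d by exact: normr_ge0.
have quad u : d * dotp (g *m u) (g *m u) = dotp u u by exact: G2_conformal.
have bil u v : d * dotp (g *m u) (g *m v) = dotp u v.
  have := quad (u + v); rewrite mulmxDr !dotpDl !dotpDr.
  rewrite [dotp v u]dotpC [dotp (g *m v) (g *m u)]dotpC !mulrDr !quad.
  by move=> e; lra.
have dS : d *: (g^T *m g) = 1%:M.
  apply: eq_mulmx_cV => u; apply: eq_dotp => v.
  by rewrite -scalemxAl dotpZl -mulmxA dotp_mul trmxK bil mul1mx.
have d1 : d = 1.
  have := congr1 (fun A => \det A) dS.
  rewrite detZ det_mulmx det_tr det1 -expr2 -(real_normK (num_real _)) -/d -exprD.
  by move=> /eqP; rewrite pexpr_eq1 // => /eqP.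
by rewrite -dS d1 scale1r.
Qed.

End G2Orthogonal.

(** * Adapted frames *)

Section AdaptedFrame.
Context {R : realType}.
Implicit Types (u v w a b c : 'cV[R]_7) (g h : 'M[R]_7).

Lemma G2P g : G2 g <-> g^T *m g = 1%:M /\
  forall u v, cross (g *m u) (g *m v) = g *m cross u v.
Proof.
split=> [Gg|[orth gc]].
  have orth := G2_tr_mul Gg; split=> // u v.
  have gK : g *m g^T = 1%:M by exact: mulmx1C.
  apply: eq_dotp => w; rewrite -phi_cross -[w in LHS]mul1mx -gK -mulmxA.
  by case: Gg => _ ->; rewrite phi_cross dotp_mul.
have [_ gU] := mulmx1_unit orth; split=> // u v w.
by rewrite !phi_cross gc dotp_mul mulmxA orth mul1mx.
Qed.

Lemma G2_unit g : G2 g -> g \in unitmx.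
Proof. by case. Qed.

Lemma G2_mul_tr g : G2 g -> g *m g^T = 1%:M.
Proof. by move=> /G2_tr_mul /mulmx1C. Qed.

Lemma G2_cross g u v : G2 g -> cross (g *m u) (g *m v) = g *m cross u v.
Proof. by move=> /G2P[]. Qed.

Lemma G2_dotp g u v : G2 g -> dotp (g *m u) (g *m v) = dotp u v.
Proof. by move=> Gg; rewrite dotp_mul mulmxA G2_tr_mul // mul1mx. Qed.

Lemma G2_1 : G2 (1%:M : 'M[R]_7).
Proof. by split=> [|u v w]; rewrite ?unitmx1 ?mul1mx. Qed.

Lemma G2_mul g h : G2 g -> G2 h -> G2 (g *m h).
Proof.
move=> [gU gp] [hU hp]; split=> [|u v w]; first by rewrite unitmx_mul gU.
by rewrite -!mulmxA gp hp.
Qed.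

Lemma G2_inv g : G2 g -> G2 (invmx g).
Proof.
move=> [gU gp]; split=> [|u v w]; first by rewrite unitmx_inv.
by rewrite -gp !mulKVmx.
Qed.

Lemma crossDl u v w : cross (u + v) w = cross u w + cross v w.
Proof. by rewrite crossC crossDr opprD -!(crossC w). Qed.

Lemma crossZl (k : R) u v : cross (k *: u) v = k *: cross u v.
Proof. by rewrite crossC crossZr -scalerN -crossC. Qed.

Lemma crossNr u v : cross u (- v) = - cross u v.
Proof. by rewrite -scaleN1r crossZr scaleN1r. Qed.

Lemma cross_id u : cross u u = 0.
Proof. by rewrite -crossmxE crossmx_id. Qed.

(** The polarised form of [crossK]. *)
Lemma cross_anticomm u v w :
  cross u (cross w v) + cross w (cross u v)
  = dotp u v *: w + dotp w v *: u - (2 * dotp u w) *: v.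
Proof.
have := crossK (u + w) v.
rewrite !crossDl !crossDr !crossK !dotpDl !dotpDr [dotp w u]dotpC.
move: (cross u (cross w v)) (cross w (cross u v)) => X Y /matrixP e.
by apply/matrixP => i j; have := e i j; rewrite !mxE => {}e; lra.
Qed.

Lemma cross_orth u v w : dotp u w = 0 -> dotp u v = 0 -> dotp w v = 0 ->
  cross u (cross w v) = - cross w (cross u v).
Proof.
move=> e1 e2 e3; apply/eqP; rewrite -addr_eq0 cross_anticomm e1 e2 e3.
by rewrite mulr0 !scale0r subr0 addr0.
Qed.

Lemma dotp_crossl u v : dotp (cross u v) u = 0.
Proof. by rewrite /dotp !sum7 !col7E //=; ring. Qed.

Lemma dotp_crossr u v : dotp (cross u v) v = 0.
Proof. by rewrite /dotp !sum7 !col7E //=; ring. Qed.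

Lemma dotp_cross_cross u v w :
  dotp (cross u v) (cross u w) = dotp u u * dotp v w - dotp u v * dotp u w.
Proof.
by rewrite dotp_cross_anti crossK dotpDr dotpNr !dotpZr [dotp v u]dotpC; ring.
Qed.

Definition cols_mx (F : 'I_7 -> 'cV[R]_7) : 'M[R]_7 := \matrix_(i, j) F j i 0.

Lemma cols_mxE F u : cols_mx F *m u = \sum_i u i 0 *: F i.
Proof.
apply: eq_col7 => i; rewrite summxE mxE; apply: eq_bigr => j _.
by rewrite !mxE mulrC.
Qed.

(** The standard basis is recovered from x^1, x^2, x^3 by the same formulas. *)
Definition adapted_frame a b c (i : 'I_7) : 'cV[R]_7 :=
  nth 0 [:: a; b; c; cross a (cross b c); cross b c; cross c a; cross a b] i.

(** Associativity fails, but left multiplications by orthogonal vectors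
    anticommute up to the metric terms of [cross_anticomm]. Together with
    [crossK] this fixes every product of two of the seven vectors, and the
    resulting table is that of the standard basis. *)
Lemma adapted_frame_G2 a b c :
  dotp a a = 1 -> dotp b b = 1 -> dotp c c = 1 ->
  dotp a b = 0 -> dotp a c = 0 -> dotp b c = 0 -> phi a b c = 0 ->
  G2 (cols_mx (adapted_frame a b c)).
Proof.
move=> aa bb cc ab ac bc; rewrite phi_cross => abc.
pose p := cross b c; pose q := cross c a; pose r := cross a b; pose d := cross a p.
have sym u v : dotp u v = 0 -> dotp v u = 0 by rewrite dotpC.
have [ba ca cb] : [/\ dotp b a = 0, dotp c a = 0 & dotp c b = 0] by split; exact: sym.
have [pb pc] : dotp p b = 0 /\ dotp p c = 0 by rewrite dotp_crossl dotp_crossr.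
have [qc qa] : dotp q c = 0 /\ dotp q a = 0 by rewrite dotp_crossl dotp_crossr.
have [ra rb] : dotp r a = 0 /\ dotp r b = 0 by rewrite dotp_crossl dotp_crossr.
have rc : dotp r c = 0 by [].
have pa : dotp p a = 0 by rewrite dotp_cross_anti crossC dotpNr opprK sym.
have qb : dotp q b = 0 by rewrite /q crossC dotpNl dotp_cross_anti opprK sym.
have pq : dotp p q = 0.
  by rewrite /p crossC dotpNl dotp_cross_cross ba ca; ring.
have pr : dotp p r = 0.
  by rewrite /r crossC dotpNr dotp_cross_cross ba ca; ring.
have qr : dotp q r = 0.
  by rewrite /q crossC dotpNl dotp_cross_cross cb ab; ring.
have pp : dotp p p = 1 by rewrite dotp_cross_cross bb cc bc; ring.
have qq : dotp q q = 1 by rewrite dotp_cross_cross aa cc ca; ring.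
have rr : dotp r r = 1 by rewrite dotp_cross_cross aa bb ab; ring.
have [da dp] : dotp d a = 0 /\ dotp d p = 0 by rewrite dotp_crossl dotp_crossr.
have db : dotp d b = 0 by rewrite dotp_cross_anti -/r pr oppr0.
have dc : dotp d c = 0 by rewrite dotp_cross_anti crossC -/q dotpNr pq !oppr0.
have dq : dotp d q = 0 by rewrite /q crossC dotpNr dotp_cross_cross pc ac; ring.
have dr : dotp d r = 0 by rewrite dotp_cross_cross pb ab; ring.
have dd : dotp d d = 1 by rewrite dotp_cross_cross aa pp (sym _ _ pa); ring.
have K u v w : dotp u u = 1 -> dotp u v = 0 -> cross u v = w -> cross u w = - v.
  by move=> uu uv <-; rewrite crossK uu uv scale0r scale1r sub0r.
have N u v w : cross u v = w -> cross v u = - w by move=> <-; rewrite -crossC.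
have K' u v w : dotp u u = 1 -> dotp u v = 0 -> cross v u = w -> cross u w = v.
  by move=> uu uv <-; rewrite (crossC u v) crossNr (K u v (cross u v)) // opprK.
have N' u v w : cross u v = - w -> cross v u = w by move=> uv; rewrite crossC uv opprK.
have [bcp caq abr apd] : [/\ cross b c = p, cross c a = q, cross a b = r & cross a p = d] by [].
(* each product below is reduced to a defining one by anticommuting *)
have crd : cross c r = d.
  by rewrite /r cross_orth // (crossC b c) crossNr opprK.
have bqd : cross b q = d.
  by rewrite /q cross_orth // (crossC a b) crossNr opprK.
have [dap dbq dcr] : [/\ cross d a = p, cross d b = q & cross d c = r].
  by split; apply: N'; apply: K => //; exact: sym.
have [pda qdb rdc] : [/\ cross p d = a, cross q d = b & cross r d = c].
  split; apply: K' => //; exact: sym.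
have [cpb pbc] : cross c p = b /\ cross p b = c.
  by split; [exact: K'|apply: N'; exact: K].
have [aqc qca] : cross a q = c /\ cross q c = a.
  by split; [exact: K'|apply: N'; exact: K].
have [bra rab] : cross b r = a /\ cross r a = b.
  by split; [exact: K'|apply: N'; exact: K].
have prq : cross p r = q by rewrite /r cross_orth // pbc -crossC.
have rqp : cross r q = p by rewrite /q cross_orth // rab -crossC.
have qpr : cross q p = r.
  by apply: N'; rewrite /q cross_orth // (N _ _ _ apd) crossNr opprK; exact: N.
pose F := adapted_frame a b c.
have F0 : F (o7 0) = a by rewrite /F /adapted_frame inordK.
have F1 : F (o7 1) = b by rewrite /F /adapted_frame inordK.
have F2 : F (o7 2) = c by rewrite /F /adapted_frame inordK.
have F3 : F (o7 3) = d by rewrite /F /adapted_frame inordK.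
have F4 : F (o7 4) = p by rewrite /F /adapted_frame inordK.
have F5 : F (o7 5) = q by rewrite /F /adapted_frame inordK.
have F6 : F (o7 6) = r by rewrite /F /adapted_frame inordK.
apply/G2P; split=> [|u v].
  apply/matrixP => i j; rewrite mxE.
  under eq_bigr => k _ do rewrite !mxE.
  rewrite -/(dotp (F i) (F j)) mxE.
  suff: dotp (F i) (F j) = (nat_of_ord i == j)%:R by [].
  by move: i j; apply: ord7P; apply: ord7P; rewrite !inordK //=;
    rewrite ?F0 ?F1 ?F2 ?F3 ?F4 ?F5 ?F6 ?mulr0n ?mulr1n //; exact: sym.
rewrite !cols_mxE !sum7 -/F F0 F1 F2 F3 F4 F5 F6.
rewrite !crossDl !crossDr !crossZl !crossZr !cross_id.
rewrite bcp caq abr apd crd bqd dap dbq dcr pda qdb rdc cpb pbc aqc qca bra rab.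
rewrite prq rqp qpr.
rewrite (N _ _ _ bcp) (N _ _ _ caq) (N _ _ _ abr) (N _ _ _ apd) (N _ _ _ crd).
rewrite (N _ _ _ bqd) (N _ _ _ dap) (N _ _ _ dbq) (N _ _ _ dcr) (N _ _ _ pda).
rewrite (N _ _ _ qdb) (N _ _ _ rdc) (N _ _ _ cpb) (N _ _ _ pbc) (N _ _ _ aqc).
rewrite (N _ _ _ qca) (N _ _ _ bra) (N _ _ _ rab) (N _ _ _ prq) (N _ _ _ rqp).
rewrite (N _ _ _ qpr) !col7E //=.
clearbody d p q r.
by apply/matrixP => i j; rewrite !mxE; ring.
Qed.

End AdaptedFrame.

(** * Transitivity of G2 on orthonormal triples *)

Section Triples.
Context {R : realType}.
Implicit Types (u v w a b c : 'cV[R]_7) (g h : 'M[R]_7) (N M : 'M[R]_(7, 3)).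

Lemma exists_unit_orth k (B : 'M[R]_(7, k)) : (k < 7)%N ->
  exists2 u, dotp u u = 1 & B^T *m u = 0.
Proof.
move=> k7.
have /rowV0Pn[x /sub_kermxP xB x0] : kermx B != 0.
  by rewrite -mxrank_eq0 mxrank_ker -lt0n subn_gt0 (leq_ltn_trans (rank_leq_col B)).
pose t := Num.sqrt (dotp x^T x^T).
have q0 : 0 < dotp x^T x^T by apply: dotp_gt0; rewrite trmx_eq0.
have tt : t ^+ 2 = dotp x^T x^T by rewrite sqr_sqrtr // ltW.
have t0 : t != 0 by rewrite gt_eqF // sqrtr_gt0.
exists (t^-1 *: x^T).
  by rewrite dotpZl dotpZr -tt; field.
by rewrite -scalemxAr -trmx_mul xB trmx0 scaler0.
Qed.

Definition o3 k : 'I_3 := inord k.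

Lemma ord3P (P : 'I_3 -> Prop) : P (o3 0) -> P (o3 1) -> P (o3 2) -> forall i, P i.
Proof.
by move=> h0 h1 h2 i; rewrite -(inord_val i); case: i; do 3?[case=> //].
Qed.

Lemma sum3 (V : nmodType) (F : 'I_3 -> V) :
  \sum_i F i = F (o3 0) + F (o3 1) + F (o3 2).
Proof.
by rewrite sum_inord !big_nat_recr //= big_nil add0r.
Qed.

(** The value of phi on the columns; it is multiplied by the determinant under a
    change of frame. *)
Definition phi3 N := phi (col (o3 0) N) (col (o3 1) N) (col (o3 2) N).

Lemma col_mulmx p q r (A : 'M[R]_(p, q)) (B : 'M[R]_(q, r)) j :
  col j (A *m B) = A *m col j B.
Proof. by rewrite !colE mulmxA. Qed.

Lemma G2_phi3 g N : G2 g -> phi3 (g *m N) = phi3 N.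
Proof. by case=> _ gp; rewrite /phi3 !col_mulmx gp. Qed.

Lemma dotp_col N i j : dotp (col i N) (col j N) = (N^T *m N) i j.
Proof. by rewrite mxE; apply: eq_bigr => k _; rewrite !mxE. Qed.

Lemma eq_cols (m n : nat) (A B : 'M[R]_(m, n)) : (forall j, col j A = col j B) -> A = B.
Proof. by move=> e; apply/matrixP => i j; have /matrixP/(_ i 0) := e j; rewrite !mxE. Qed.

Definition e7 k : 'cV[R]_7 := delta_mx (o7 k) 0.

Lemma cols_mx_e7 (F : 'I_7 -> 'cV[R]_7) k : cols_mx F *m e7 k = F (o7 k).
Proof. by rewrite -colE; apply: eq_col7 => i; rewrite !mxE. Qed.

(** The vector n_0 x n_1 - c n_2 has square length 1 - c^2. *)
Lemma phi3_le1 N : N^T *m N = 1%:M -> phi3 N ^+ 2 <= 1.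
Proof.
move=> NN; have d i j := dotp_col N i j; rewrite NN in d.
set c := phi3 N.
have := dotp_ge0 (cross (col (o3 0) N) (col (o3 1) N) - c *: col (o3 2) N).
rewrite !dotpDl !dotpDr !dotpNl !dotpNr !dotpZl !dotpZr dotp_cross_cross.
rewrite [dotp (col (o3 2) N) (cross _ _)]dotpC -phi_cross -/(phi3 N) -/c.
by rewrite !d !mxE -!val_eqE /= !inordK //= => h; lra.
Qed.

Definition triple_mx (c s : R) : 'M[R]_(7, 3) :=
  \matrix_(i, j) (nth 0 [:: e7 0; e7 1; c *: e7 6 + s *: e7 2] j) i 0.

(** If n_2 = c (n_0 x n_1) + s v with v a unit vector, then phi vanishes on
    n_0, n_1, v, and the frame adapted to these three vectors carries the
    standard triple to the given one. *)
Lemma triple_normal_form N : N^T *m N = 1%:M ->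
  exists2 P, G2 P & N = P *m triple_mx (phi3 N) (Num.sqrt (1 - phi3 N ^+ 2)).
Proof.
move=> NN; have c_le1 := phi3_le1 NN; have d i j := dotp_col N i j; rewrite NN in d.
set c := phi3 N in c_le1 *; set s := Num.sqrt _.
have ss : s ^+ 2 = 1 - c ^+ 2 by rewrite sqr_sqrtr // subr_ge0.
set n0 := col (o3 0) N; set n1 := col (o3 1) N; set n2 := col (o3 2) N.
have d00 : dotp n0 n0 = 1 by rewrite d mxE eqxx.
have d11 : dotp n1 n1 = 1 by rewrite d mxE eqxx.
have d22 : dotp n2 n2 = 1 by rewrite d mxE eqxx.
have d01 : dotp n0 n1 = 0 by rewrite d mxE -val_eqE /= !inordK.
have d02 : dotp n0 n2 = 0 by rewrite d mxE -val_eqE /= !inordK.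
have d12 : dotp n1 n2 = 0 by rewrite d mxE -val_eqE /= !inordK.
pose m := cross n0 n1.
have mm : dotp m m = 1 by rewrite dotp_cross_cross d00 d11 d01; ring.
have m0 : dotp m n0 = 0 by rewrite dotp_crossl.
have m1 : dotp m n1 = 0 by rewrite dotp_crossr.
have m2 : dotp m n2 = c by rewrite -phi_cross.
have [v [vv v0 v1 vm n2E]] : exists v, [/\ dotp v v = 1, dotp n0 v = 0, dotp n1 v = 0,
    dotp m v = 0 & n2 = c *: m + s *: v].
  have [s0|s0] := eqVneq s 0; last first.
    exists (s^-1 *: (n2 - c *: m)); split.
    - rewrite dotpZl dotpZr dotpDl !dotpDr !dotpNl !dotpNr !dotpZl !dotpZr.
      rewrite [dotp n2 m]dotpC d22 m2 mm; field: ss.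
      by [].
    - by rewrite dotpZr dotpDr dotpNr dotpZr [dotp n0 m]dotpC d02 m0; ring.
    - by rewrite dotpZr dotpDr dotpNr dotpZr [dotp n1 m]dotpC d12 m1; ring.
    - by rewrite dotpZr dotpDr dotpNr dotpZr m2 mm; ring.
    - by rewrite scalerA divff // scale1r addrC subrK.
  (* for s = 0 any unit vector orthogonal to the associative span will do *)
  have [v vv vB] := exists_unit_orth (row_mx (row_mx n0 n1) m) isT.
  have : (row_mx (row_mx n0 n1) m)^T *m v = 0 by [].
  rewrite !tr_row_mx !mul_col_mx => /eqP; rewrite !col_mx_eq0.
  move=> /andP[/andP[/eqP v0 /eqP v1] /eqP vm].
  exists v; split=> //; try by rewrite dotpE ?v0 ?v1 ?vm mxE.
  rewrite s0 scale0r addr0; apply/eqP; rewrite -subr_eq0; apply/eqP/dotp_eq0.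
  rewrite dotpDl !dotpDr !dotpNl !dotpNr !dotpZl !dotpZr [dotp n2 m]dotpC d22 m2 mm.
  by move: ss; rewrite s0; nra.
exists (cols_mx (adapted_frame n0 n1 v)); first by apply: adapted_frame_G2 => //; rewrite phi_cross.
apply: eq_cols; apply: ord3P; rewrite col_mulmx.
- rewrite (_ : col _ (triple_mx _ _) = e7 0); last by apply: eq_col7 => i; rewrite 2![LHS]mxE inordK.
  by rewrite cols_mx_e7 /adapted_frame inordK.
- rewrite (_ : col _ (triple_mx _ _) = e7 1); last by apply: eq_col7 => i; rewrite 2![LHS]mxE inordK.
  by rewrite cols_mx_e7 /adapted_frame inordK.
- rewrite (_ : col _ (triple_mx _ _) = c *: e7 6 + s *: e7 2); last first.
    by apply: eq_col7 => i; rewrite 2![LHS]mxE inordK.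
  by rewrite mulmxDr -!scalemxAr !cols_mx_e7 /adapted_frame !inordK.
Qed.

Lemma G2_triple_transitive N M : N^T *m N = 1%:M -> M^T *m M = 1%:M ->
  phi3 N = phi3 M -> exists2 g, G2 g & g *m M = N.
Proof.
move=> /triple_normal_form[P GP NE] /triple_normal_form[Q GQ ME] e.
exists (P *m invmx Q); first by apply: G2_mul => //; exact: G2_inv.
by rewrite [in LHS]ME mulmxA mulmxKV ?(G2_unit GQ) // -e -NE.
Qed.

End Triples.

(** * Four-planes and their normal frames *)

Section NormalFrames.
Context {R : realType}.
Implicit Types (u v w : 'cV[R]_7) (g h : 'M[R]_7) (N M : 'M[R]_(7, 3)).
Implicit Types (xi eta : @Gr R 7 4).

Definition perp N : {vspace 'cV[R]_7} :=
  lker (linfun (mulmx N^T : 'cV[R]_7 -> 'cV[R]_3)).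

(** Four-planes are handled through orthonormal frames of their normal spaces,
    which carry the three-form without any Hodge star. *)
Definition normal_frame N xi := N^T *m N = 1%:M /\ val xi = perp N.

Lemma mem_perp N v : (v \in perp N) = (N^T *m v == 0).
Proof. by rewrite memv_ker lfunE. Qed.

Lemma dim_cV n : \dim {: 'cV[R]_n} = n.
Proof. by rewrite dimvf /dim /= muln1. Qed.

Lemma dim_perp N : N^T *m N = 1%:M -> \dim (perp N) = 4.
Proof.
move=> NN; have := limg_ker_dim (linfun (mulmx N^T : 'cV[R]_7 -> 'cV[R]_3)) fullv.
rewrite capfv -/(perp N) dim_cV.
have -> : (linfun (mulmx N^T : 'cV[R]_7 -> 'cV[R]_3) @: fullv)%VS = fullv.
  apply/vspaceP => x; rewrite memvf; apply/memv_imgP.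
  by exists (N *m x); rewrite ?memvf // lfunE /= mulmxA NN mul1mx.
by rewrite dim_cV => /eqP; rewrite (eqn_add2r 3 _ 4) => /eqP.
Qed.

Lemma normal_frame_Gr N : N^T *m N = 1%:M -> exists xi, normal_frame N xi.
Proof.
move=> NN; have k4 : \dim (perp N) == 4 by rewrite dim_perp.
by exists (exist (fun U : {vspace 'cV[R]_7} => \dim U == 4) _ k4).
Qed.

Lemma normal_frame_inj N xi eta : normal_frame N xi -> normal_frame N eta -> xi = eta.
Proof. by move=> [_ e1] [_ e2]; apply: val_inj; rewrite e1 e2. Qed.

Lemma exists_normal_frame xi : exists N, normal_frame N xi.
Proof.
have d4 : \dim (val xi) = 4 by apply/eqP; exact: (valP xi).
pose B : 'M[R]_(7, \dim (val xi)) := \matrix_(i, j) (vbasis (val xi))`_j i 0.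
have k4 : (\dim (val xi) < 7)%N by rewrite d4.
have k5 : (\dim (val xi) + 1 < 7)%N by rewrite d4.
have k6 : (\dim (val xi) + 1 + 1 < 7)%N by rewrite d4.
have [n0 n00 Bn0] := exists_unit_orth B k4.
have [n1 n11 ] := exists_unit_orth (row_mx B n0) k5.
rewrite tr_row_mx mul_col_mx => /eqP; rewrite col_mx_eq0 => /andP[/eqP Bn1 /eqP n01].
have [n2 n22 ] := exists_unit_orth (row_mx (row_mx B n0) n1) k6.
rewrite !tr_row_mx !mul_col_mx => /eqP; rewrite !col_mx_eq0.
move=> /andP[/andP[/eqP Bn2 /eqP n02] /eqP n12].
pose N : 'M[R]_(7, 3) := \matrix_(i, j) (nth 0 [:: n0; n1; n2] j) i 0.
have N0 : col (o3 0) N = n0 by apply: eq_col7 => i; rewrite !mxE inordK.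
have N1 : col (o3 1) N = n1 by apply: eq_col7 => i; rewrite !mxE inordK.
have N2 : col (o3 2) N = n2 by apply: eq_col7 => i; rewrite !mxE inordK.
have d0 u v : u^T *m v = 0 -> dotp u v = 0 /\ dotp v u = 0.
  by move=> uv; rewrite [dotp v u]dotpC !dotpE uv mxE.
have NN : N^T *m N = 1%:M.
  apply/matrixP => i j; rewrite -dotp_col mxE.
  suff : dotp (col i N) (col j N) = (nat_of_ord i == j)%:R by [].
  have [d01 d10] := d0 _ _ n01; have [d02 d20] := d0 _ _ n02.
  have [d12 d21] := d0 _ _ n12.
  by move: i j; apply: ord3P; apply: ord3P; rewrite !inordK // ?N0 ?N1 ?N2.
have NB : N^T *m B = 0.
  apply: trmx_inj; rewrite trmx_mul trmxK trmx0; apply: eq_cols.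
  by apply: ord3P; rewrite col_mulmx ?N0 ?N1 ?N2 ?Bn0 ?Bn1 ?Bn2; apply/matrixP => ? ?; rewrite !mxE.
exists N; split=> //.
apply/eqP; rewrite eqEdim (dim_perp NN) d4 leqnn andbT.
apply/subvP => v vxi; rewrite mem_perp (coord_vbasis vxi) mulmx_sumr.
apply/eqP; apply: big1 => i _; rewrite -scalemxAr.
have -> : (vbasis (val xi))`_i = col i B by apply: eq_col7 => j; rewrite !mxE.
by rewrite -col_mulmx NB; apply/matrixP => ? ?; rewrite !mxE mulr0.
Qed.

(** The projection 1 - N N^T has its image in the plane, which M^T annihilates. *)
Lemma perp_factor N M xi : normal_frame N xi -> val xi = perp M ->
  M = N *m (N^T *m M).
Proof.
move=> [NN Nxi] Mxi.
have e : M^T *m (1%:M - N *m N^T) = 0.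
  apply: eq_mulmx_cV => v; rewrite mul0mx -mulmxA.
  apply/eqP; rewrite -mem_perp -Mxi Nxi mem_perp.
  by rewrite mulmxBl mul1mx mulmxBr !mulmxA NN mul1mx subrr.
move/eqP: e; rewrite mulmxBr mulmx1 subr_eq0 => /eqP /(congr1 trmx).
by rewrite !trmx_mul !trmxK -mulmxA.
Qed.

Lemma normal_frame_unique N M xi : normal_frame N xi -> normal_frame M xi ->
  (N^T *m M)^T *m (N^T *m M) = 1%:M /\ M = N *m (N^T *m M).
Proof.
move=> Nxi [MM Mxi]; have MNN := perp_factor Nxi Mxi.
by split=> //; rewrite trmx_mul trmxK -mulmxA -MNN.
Qed.

Lemma normal_frame_mul N xi (Q : 'M[R]_3) : Q^T *m Q = 1%:M ->
  normal_frame N xi -> normal_frame (N *m Q) xi.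
Proof.
move=> QQ [NN Nxi]; split.
  by rewrite trmx_mul mulmxA -[_ *m _ *m N]mulmxA NN mulmx1.
rewrite Nxi; apply/vspaceP => v; rewrite !mem_perp trmx_mul -mulmxA.
apply/eqP/eqP => [->|/(congr1 (mulmx Q))]; first by rewrite mulmx0.
by rewrite mulmxA (mulmx1C QQ) mul1mx mulmx0.
Qed.

Lemma normal_frame_act g N xi : G2 g -> normal_frame N xi ->
  normal_frame (g *m N) (Gr_act g xi).
Proof.
move=> Gg [NN Nxi]; split.
  by rewrite trmx_mul mulmxA -[_ *m _ *m g]mulmxA G2_tr_mul // mulmx1.
rewrite Gr_actE ?(G2_unit Gg) // Nxi; apply/vspaceP => v.
rewrite mem_perp trmx_mul -mulmxA; apply/memv_imgP/eqP.
  move=> [w]; rewrite mem_perp => /eqP Nw ->.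
  by rewrite lfunE /= [g^T *m _]mulmxA G2_tr_mul // mul1mx.
move=> e; exists (g^T *m v); first by rewrite mem_perp e.
by rewrite lfunE /= mulmxA G2_mul_tr // mul1mx.
Qed.

Lemma phiDl u v w w' : phi (u + v) w w' = phi u w w' + phi v w w'.
Proof. by rewrite !phi_cross crossDl dotpDl. Qed.
Lemma phiDm u v w w' : phi u (v + w) w' = phi u v w' + phi u w w'.
Proof. by rewrite !phi_cross crossDr dotpDl. Qed.
Lemma phiDr u v w w' : phi u v (w + w') = phi u v w + phi u v w'.
Proof. by rewrite !phi_cross dotpDr. Qed.
Lemma phiZl (k : R) u v w : phi (k *: u) v w = k * phi u v w.
Proof. by rewrite !phi_cross crossZl dotpZl. Qed.
Lemma phiZm (k : R) u v w : phi u (k *: v) w = k * phi u v w.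
Proof. by rewrite !phi_cross crossZr dotpZl. Qed.
Lemma phiZr (k : R) u v w : phi u v (k *: w) = k * phi u v w.
Proof. by rewrite !phi_cross dotpZr. Qed.
Lemma phi_swap u v w : phi u v w = - phi v u w.
Proof. by rewrite !phi_cross crossC dotpNl. Qed.
Lemma phi_cyc u v w : phi u v w = phi v w u.
Proof. by rewrite !phi_cross /dotp !sum7 !col7E //=; ring. Qed.
Lemma phi_0l u w : phi u u w = 0.
Proof. by rewrite phi_cross cross_id /dotp big1 // => i _; rewrite mxE mul0r. Qed.

Lemma phi_0m u w : phi u w u = 0.
Proof. by rewrite -phi_cyc phi_0l. Qed.
Lemma phi_0r u w : phi u w w = 0.
Proof. by rewrite phi_cyc phi_0l. Qed.

Lemma det3 (Q : 'M[R]_3) (q := fun i j => Q (o3 i) (o3 j)) :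
  \det Q = q 0%N 0%N * (q 1%N 1%N * q 2%N 2%N - q 1%N 2%N * q 2%N 1%N)
    - q 0%N 1%N * (q 1%N 0%N * q 2%N 2%N - q 1%N 2%N * q 2%N 0%N)
    + q 0%N 2%N * (q 1%N 0%N * q 2%N 1%N - q 1%N 1%N * q 2%N 0%N).
Proof.
have -> : Q = \matrix_(i < 3, j < 3) q i j.
  by apply/matrixP => i j; rewrite mxE /q /o3 !inord_val.
move: q => q.
rewrite (expand_det_row _ ord0) !big_ord_recl big_ord0 /cofactor !(expand_det_row _ ord0).
rewrite !big_ord_recl !big_ord0 /cofactor !det_mx11 !mxE /=.
by rewrite /bump /= ?addn0 ?add0n ?add1n; ring.
Qed.

Lemma phi3_mul N (Q : 'M[R]_3) : phi3 (N *m Q) = \det Q * phi3 N.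
Proof.
have c j : col j (N *m Q) = Q (o3 0) j *: col (o3 0) N + Q (o3 1) j *: col (o3 1) N
    + Q (o3 2) j *: col (o3 2) N.
  by apply: eq_col7 => i; rewrite !mxE sum3; ring.
rewrite det3 /phi3 !c.
move: (col _ N) (col _ N) (col _ N) => n0 n1 n2.
rewrite !phiDl !phiDm !phiDr !phiZl !phiZm !phiZr !phi_0l !phi_0m !phi_0r.
have e120 : phi n1 n2 n0 = phi n0 n1 n2 by rewrite -phi_cyc.
have e201 : phi n2 n0 n1 = phi n0 n1 n2 by rewrite phi_cyc.
rewrite (phi_swap n1 n0) (phi_swap n0 n2) (phi_swap n2 n1) e120 e201.
ring.
Qed.

Lemma det_orth_sq n (Q : 'M[R]_n) : Q^T *m Q = 1%:M -> \det Q ^+ 2 = 1.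
Proof. by move/(congr1 determinant); rewrite det_mulmx det_tr det1 expr2. Qed.

Lemma normal_frame_phi3_sq N M xi : normal_frame N xi -> normal_frame M xi ->
  phi3 N ^+ 2 = phi3 M ^+ 2.
Proof.
move=> Nxi Mxi; have [QQ ->] := normal_frame_unique Nxi Mxi.
by rewrite phi3_mul exprMn det_orth_sq ?mul1r.
Qed.

(** Changing the sign of one frame if necessary, equal squares become equal
    values, and transitivity on triples applies. *)
Lemma same_orbitP N M xi eta : normal_frame N xi -> normal_frame M eta ->
  (exists2 g, G2 g & Gr_act g eta = xi) <-> phi3 N ^+ 2 = phi3 M ^+ 2.
Proof.
move=> Nxi Meta; split=> [[g Gg gxi]|e].
  rewrite -(G2_phi3 M Gg); apply: normal_frame_phi3_sq Nxi _.
  by rewrite -gxi; exact: normal_frame_act.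
suff [M' M'eta e'] : exists2 M', normal_frame M' eta & phi3 N = phi3 M'.
  have [g Gg gM] := G2_triple_transitive Nxi.1 M'eta.1 e'.
  exists g => //; apply: normal_frame_inj Nxi; rewrite -gM.
  exact: normal_frame_act.
move/eqP: e; rewrite eqf_sqr => /orP[/eqP e|/eqP e]; first by exists M.
exists (M *m (-1)%:M); last by rewrite phi3_mul det_scalar e; ring.
by apply: normal_frame_mul => //; rewrite tr_scalar_mx -scalar_mxM mulrNN mulr1.
Qed.

End NormalFrames.

(** * The three-form in blocks of size 3, 1, 3, and the model frames *)

Section Models.
Context {R : realType}.
Implicit Types (u v w : 'cV[R]_7) (g h : 'M[R]_7) (N M : 'M[R]_(7, 3)).
Implicit Types (x y z : 'cV[R]_3) (A Q : 'M[R]_3).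

(** The coordinates x, r^0 and (r^1, r^2, r^3) as three blocks; p columns at a time. *)
Definition vec7 p (x : 'M[R]_(3, p)) (r : 'M[R]_(1, p)) (y : 'M[R]_(3, p)) :
  'M[R]_(7, p) := col_mx x (col_mx r y).

Lemma vec7_x p (x y : 'M[R]_(3, p)) r k j : (k < 3)%N -> vec7 x r y (o7 k) j = x (o3 k) j.
Proof.
move=> k3; rewrite (_ : o7 k = lshift (1 + 3) (o3 k)) ?[LHS]col_mxEu //.
by apply: val_inj; rewrite /= !inordK // (ltn_trans k3).
Qed.

Lemma vec7_r p (x y : 'M[R]_(3, p)) r j : vec7 x r y (o7 3) j = r 0 j.
Proof.
rewrite (_ : o7 3 = rshift 3 (lshift 3 (0 : 'I_1))) ?[LHS]col_mxEd ?[LHS]col_mxEu //.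
by apply: val_inj; rewrite /= !inordK.
Qed.

Lemma vec7_y p (x y : 'M[R]_(3, p)) r k j : (k < 3)%N ->
  vec7 x r y (o7 (4 + k)) j = y (o3 k) j.
Proof.
move=> k3; rewrite (_ : o7 (4 + k) = rshift 3 (rshift 1 (o3 k))) ?[LHS]col_mxEd ?[LHS]col_mxEd //.
by apply: val_inj; rewrite /= !inordK // -[7%N]/(4 + 3)%N ltn_add2l.
Qed.

Lemma vec7E p (x y : 'M[R]_(3, p)) r j :
  [/\ vec7 x r y (o7 0) j = x (o3 0) j, vec7 x r y (o7 1) j = x (o3 1) j &
      vec7 x r y (o7 2) j = x (o3 2) j] /\
  [/\ vec7 x r y (o7 3) j = r 0 j, vec7 x r y (o7 4) j = y (o3 0) j,
      vec7 x r y (o7 5) j = y (o3 1) j & vec7 x r y (o7 6) j = y (o3 2) j].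
Proof.
by do !split; rewrite ?vec7_r //; [exact: vec7_x|exact: vec7_x|exact: vec7_x|
  exact: (@vec7_y _ _ _ _ 0)|exact: (@vec7_y _ _ _ _ 1)|exact: (@vec7_y _ _ _ _ 2)].
Qed.

Lemma vec7_split p (u : 'M[R]_(7, p)) : exists (x : 'M[R]_(3, p)) r (y : 'M[R]_(3, p)), u = vec7 x r y.
Proof.
exists (usubmx (u : 'M[R]_(3 + (1 + 3), p))), (usubmx (dsubmx (u : 'M[R]_(3 + (1 + 3), p)))),
  (dsubmx (dsubmx (u : 'M[R]_(3 + (1 + 3), p)))).
by rewrite /vec7 !vsubmxK.
Qed.

Definition mat3 x y z : 'M[R]_3 := \matrix_(i, j) (nth 0 [:: x; y; z] j) i 0.

Lemma mat3_mul A x y z : A *m mat3 x y z = mat3 (A *m x) (A *m y) (A *m z).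
Proof.
apply/matrixP => i; apply: ord3P; rewrite !mxE.
all: by rewrite inordK //= mxE; apply: eq_bigr => k _; rewrite mxE inordK.
Qed.

(** The first line is dr^0 wedge the Kaehler form, the rest is minus the real part
    of the complex volume form for z = r + i x. *)
Lemma phi_vec7 x r y x' r' y' x'' r'' y'' (dot := fun a b : 'cV[R]_3 => (a^T *m b) 0 0) :
  phi (vec7 x r y) (vec7 x' r' y') (vec7 x'' r'' y'') =
  r 0 0 * (dot x' y'' - dot y' x'') + r' 0 0 * (dot x'' y - dot y'' x)
    + r'' 0 0 * (dot x y' - dot y x')
  + \det (mat3 x x' y'') + \det (mat3 x' x'' y) + \det (mat3 x'' x y')
  - \det (mat3 y y' y'').
Proof.
rewrite phi_cross /dotp sum7 !col7E //=.
have [[-> -> ->] [-> -> -> ->]] := vec7E x y r 0.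
have [[-> -> ->] [-> -> -> ->]] := vec7E x' y' r' 0.
have [[-> -> ->] [-> -> -> ->]] := vec7E x'' y'' r'' 0.
rewrite !det3 /dot !mxE !sum3 !inordK //= !mxE; ring.
Qed.

Definition diag7 A (e : R) (B : 'M[R]_3) : 'M[R]_7 :=
  block_mx A 0 0 (block_mx (e%:M : 'M[R]_1) 0 0 B).

Lemma diag7_vec7 A e (B : 'M[R]_3) p (x y : 'M[R]_(3, p)) r :
  diag7 A e B *m vec7 x r y = vec7 (A *m x) (e *: r) (B *m y).
Proof.
pose E : 'M[R]_(1 + 3) := block_mx e%:M 0 0 B.
rewrite [LHS](mul_block_col A 0 0 E x (col_mx r y)) mul_block_col !mul0mx !addr0 !add0r.
by rewrite mul_scalar_mx.
Qed.

Lemma diag7_mul A e (B : 'M[R]_3) A' e' (B' : 'M[R]_3) :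
  diag7 A e B *m diag7 A' e' B' = diag7 (A *m A') (e * e') (B *m B').
Proof.
pose E : 'M[R]_(1 + 3) := block_mx e%:M 0 0 B.
pose E' : 'M[R]_(1 + 3) := block_mx e'%:M 0 0 B'.
rewrite [LHS](mulmx_block A 0 0 E A' 0 0 E') mulmx_block /diag7.
by rewrite !(mul0mx, mulmx0, addr0, add0r) -scalar_mxM.
Qed.

Lemma diag7_1 : diag7 1%:M 1 1%:M = 1%:M.
Proof. by rewrite /diag7 -!scalar_mx_block. Qed.

(** For e = det A the inner products are multiplied by e.e = 1, and each of the
    determinants by e^2 or by e^4, which is 1 as well. *)
Lemma diag7_G2 A : A^T *m A = 1%:M -> G2 (diag7 A (\det A) (\det A *: A)).
Proof.
move=> AA; have ee : \det A ^+ 2 = 1 := det_orth_sq AA.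
have AA' := mulmx1C AA; split.
  have e : diag7 A (\det A) (\det A *: A) *m diag7 A^T (\det A) (\det A *: A^T) = 1%:M.
    by rewrite diag7_mul AA' -scalemxAl -scalemxAr AA' scalerA -expr2 ee scale1r diag7_1.
  by have [] := mulmx1_unit e.
move=> u v w.
have [x [r [y ->]]] := vec7_split u.
have [x' [r' [y' ->]]] := vec7_split v.
have [x'' [r'' [y'' ->]]] := vec7_split w.
rewrite !diag7_vec7 !phi_vec7.
have dA (a b : 'cV[R]_3) : (A *m a)^T *m (A *m b) = a^T *m b.
  by rewrite trmx_mul mulmxA -[_ *m _ *m A]mulmxA AA mulmx1.
have eA (a : 'cV[R]_3) : (\det A *: A) *m a = A *m (\det A *: a).
  by rewrite -scalemxAl scalemxAr.
rewrite !eA -!mat3_mul !det_mulmx !dA.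
have m3 (e1 e2 e3 : R) (a b c : 'cV[R]_3) :
    \det (mat3 (e1 *: a) (e2 *: b) (e3 *: c)) = e1 * e2 * e3 * \det (mat3 a b c).
  rewrite !det3 !mxE !inordK //= !mxE; ring.
have m3z e3 a b c : \det (mat3 a b (e3 *: c)) = e3 * \det (mat3 a b c).
  by rewrite -[a in LHS]scale1r -[b in LHS]scale1r m3; ring.
have dzl (k : R) (a b : 'cV[R]_3) : ((k *: a)^T *m b) 0 0 = k * (a^T *m b) 0 0.
  by rewrite linearZ /= -scalemxAl mxE.
have dzr (k : R) (a b : 'cV[R]_3) : (a^T *m (k *: b)) 0 0 = k * (a^T *m b) 0 0.
  by rewrite -scalemxAr mxE.
have zE (k : R) (a : 'cV[R]_1) : (k *: a) 0 0 = k * a 0 0 by rewrite mxE.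
rewrite m3 !m3z !dzl !dzr !zE.
by ring: ee.
Qed.

(** The frame of (a + i b) R^3 in C^3, with z = r + i x. *)
Definition model (a b : R) : 'M[R]_(7, 3) := vec7 b%:M 0 a%:M.

End Models.

(** * Stabilisers of the model planes *)

Section ModelStabilisers.
Context {R : realType}.
Implicit Types (u v w : 'cV[R]_7) (g h k : 'M[R]_7) (N M : 'M[R]_(7, 3)).
Implicit Types (A Q : 'M[R]_3) (a b : R).

Lemma col_model a b : [/\ col (o3 0) (model a b) = col7 [:: b; 0; 0; 0; a; 0; 0],
  col (o3 1) (model a b) = col7 [:: 0; b; 0; 0; 0; a; 0] &
  col (o3 2) (model a b) = col7 [:: 0; 0; b; 0; 0; 0; a]].
Proof.
have E j := vec7E (b%:M : 'M[R]_3) a%:M 0 j; rewrite -/(model a b) in E.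
by split; apply: eq_col7; apply: ord7P; rewrite [LHS]mxE [RHS]col7E //=;
  (have [[E0 E1 E2] [E3 E4 E5 E6]] := E (o3 0));
  (have [[F0 F1 F2] [F3 F4 F5 F6]] := E (o3 1));
  (have [[G0 G1 G2] [G3 G4 G5 G6]] := E (o3 2));
  rewrite ?(E0, E1, E2, E3, E4, E5, E6, F0, F1, F2, F3, F4, F5, F6)
    ?(G0, G1, G2, G3, G4, G5, G6) mxE -?val_eqE /= ?inordK.
Qed.

Lemma model_orth a b : a ^+ 2 + b ^+ 2 = 1 -> (model a b)^T *m model a b = 1%:M.
Proof.
move=> ab; have [c0 c1 c2] := col_model a b.
apply/matrixP => i j; rewrite -dotp_col mxE.
suff: dotp (col i (model a b)) (col j (model a b)) = (nat_of_ord i == j)%:R by [].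
move: i j; apply: ord3P; apply: ord3P; rewrite !inordK // ?c0 ?c1 ?c2.
all: rewrite /dotp sum7 !col7E //=. all: by lra.
Qed.

(** This is minus the real part of (a + i b)^3. *)
Lemma phi3_model a b : phi3 (model a b) = 3 * a * b ^+ 2 - a ^+ 3.
Proof.
have [c0 c1 c2] := col_model a b; rewrite /phi3 c0 c1 c2.
by rewrite phi_cross /dotp sum7 !col7E //= ; ring.
Qed.

Lemma e7E i : (i < 7)%N -> e7 i = col7 (mkseq (fun j => (j == i)%:R) 7) :> 'cV[R]_7.
Proof.
move=> i7; apply: eq_col7 => j; rewrite !mxE nth_mkseq // -val_eqE /= inordK //.
by rewrite andbT.
Qed.

Lemma solve2 n (a b c d : R) (X Y : 'cV[R]_n) : a * d - b * c != 0 ->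
  a *: X + b *: Y = 0 -> c *: X + d *: Y = 0 -> X = 0 /\ Y = 0.
Proof.
move=> D e1 e2.
have eX : (a * d - b * c) *: X = d *: (a *: X + b *: Y) - b *: (c *: X + d *: Y).
  by apply/matrixP => i j; rewrite !mxE; ring.
have eY : (a * d - b * c) *: Y = a *: (c *: X + d *: Y) - c *: (a *: X + b *: Y).
  by apply/matrixP => i j; rewrite !mxE; ring.
move: eX eY; rewrite e1 e2 !scaler0 !subr0 => /eqP eX /eqP eY.
by move: eX eY; rewrite !scaler_eq0 (negbTE D) /= => /eqP-> /eqP->.
Qed.

(** The products of two vectors of the frame lie on the line of - (a - i b)^2 e_k,
    the form taken by the complex cross product of two multiples of real vectors. *)
Lemma cross_model a b (M := model a b) :
  [/\ cross (col (o3 0) M) (col (o3 1) M) = col7 [:: 0; 0; 2 * a * b; 0; 0; 0; b ^+ 2 - a ^+ 2],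
  cross (col (o3 1) M) (col (o3 2) M) = col7 [:: 2 * a * b; 0; 0; 0; b ^+ 2 - a ^+ 2; 0; 0] &
  cross (col (o3 2) M) (col (o3 0) M) = col7 [:: 0; 2 * a * b; 0; 0; 0; b ^+ 2 - a ^+ 2; 0]].
Proof.
rewrite /M; have [-> -> ->] := col_model a b.
by split; apply: eq_col7; apply: ord7P; rewrite [LHS]col7E // [RHS]col7E // !col7E //=; ring.
Qed.

(** The fixed vectors of an element of G2 are closed under the cross product. With
    the frame they contain, in each complex line, the vectors a + i b and
    - (a - i b)^2, which are independent because the imaginary part of (a + i b)^3
    is not zero; hence both complex directions, and finally r_0 as a product. *)
Lemma model_rigid a b k : b * (b ^+ 2 - 3 * a ^+ 2) != 0 -> G2 k ->
  k *m model a b = model a b -> k = 1%:M.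
Proof.
move=> D Gk kM.
have fixc j : k *m col j (model a b) = col j (model a b) by rewrite -col_mulmx kM.
have fixx i j : k *m cross (col i (model a b)) (col j (model a b)) =
    cross (col i (model a b)) (col j (model a b)) by rewrite -G2_cross // !fixc.
have [c0 c1 c2] := col_model a b; have [x01 x12 x20] := cross_model a b.
have {}D : b * (b ^+ 2 - a ^+ 2) - a * (2 * a * b) != 0.
  by rewrite (_ : _ - _ = b * (b ^+ 2 - 3 * a ^+ 2)) //; ring.
have fix2 p q (ps := fun x y => x *: e7 p + y *: e7 q : 'cV[R]_7) :
    k *m ps b a = ps b a -> k *m ps (2 * a * b) (b ^+ 2 - a ^+ 2) =
      ps (2 * a * b) (b ^+ 2 - a ^+ 2) ->
    k *m e7 p = e7 p /\ k *m e7 q = e7 q.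
  rewrite /ps !mulmxDr -!scalemxAr => e1 e2.
  have [] := @solve2 _ b a (2 * a * b) (b ^+ 2 - a ^+ 2) (k *m e7 p - e7 p)
    (k *m e7 q - e7 q) D.
  - by rewrite !scalerBr addrACA e1 -opprD subrr.
  - by rewrite !scalerBr addrACA e2 -opprD subrr.
  by move=> /eqP + /eqP; rewrite !subr_eq0 => /eqP-> /eqP->.
have E0 (x y : R) : col7 [:: x; 0; 0; 0; y; 0; 0] = x *: e7 0 + y *: e7 4.
  by apply: eq_col7; apply: ord7P; rewrite [LHS]col7E // !mxE -!val_eqE /= !inordK //=; ring.
have E1 (x y : R) : col7 [:: 0; x; 0; 0; 0; y; 0] = x *: e7 1 + y *: e7 5.
  by apply: eq_col7; apply: ord7P; rewrite [LHS]col7E // !mxE -!val_eqE /= !inordK //=; ring.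
have E2 (x y : R) : col7 [:: 0; 0; x; 0; 0; 0; y] = x *: e7 2 + y *: e7 6.
  by apply: eq_col7; apply: ord7P; rewrite [LHS]col7E // !mxE -!val_eqE /= !inordK //=; ring.
have [k0 k4] : k *m e7 0 = e7 0 /\ k *m e7 4 = e7 4.
  by apply: fix2; [have := fixc (o3 0); rewrite c0 E0
                  |have := fixx (o3 1) (o3 2); rewrite x12 E0].
have [k1 k5] : k *m e7 1 = e7 1 /\ k *m e7 5 = e7 5.
  by apply: fix2; [have := fixc (o3 1); rewrite c1 E1
                  |have := fixx (o3 2) (o3 0); rewrite x20 E1].
have [k2 k6] : k *m e7 2 = e7 2 /\ k *m e7 6 = e7 6.
  by apply: fix2; [have := fixc (o3 2); rewrite c2 E2
                  |have := fixx (o3 0) (o3 1); rewrite x01 E2].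
(* the remaining basis vector is the product of x^1 and r^1 *)
have k3 : k *m e7 3 = e7 3.
  suff <- : cross (e7 0) (e7 4) = e7 3 :> 'cV[R]_7 by rewrite -G2_cross // k0 k4.
  by apply: eq_col7; apply: ord7P; rewrite [LHS]col7E // !e7E // !col7E //=; ring.
apply: eq_cols; apply: ord7P; rewrite !colE mul1mx -/(e7 _) //.
Qed.

Lemma Gr_act_mul g h (xi : @Gr R 7 4) : G2 g -> G2 h ->
  Gr_act g (Gr_act h xi) = Gr_act (g *m h) xi.
Proof.
move=> Gg Gh; have [N Nxi] := exists_normal_frame xi.
apply: (@normal_frame_inj _ (g *m h *m N)).
  by rewrite -mulmxA; do 2!apply: normal_frame_act => //.
by apply: normal_frame_act => //; exact: G2_mul.
Qed.

Lemma Gr_act1 (xi : @Gr R 7 4) : Gr_act 1%:M xi = xi.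
Proof.
have [N Nxi] := exists_normal_frame xi.
apply: (@normal_frame_inj _ N) => //; rewrite -[N]mul1mx.
by apply: normal_frame_act => //; exact: G2_1.
Qed.

(** An element stabilises the plane when it maps a normal frame to another one, and
    these differ by an orthogonal matrix. *)
Lemma stabiliser_frame N (xi : @Gr R 7 4) g : normal_frame N xi -> G2 g ->
  (Gr_act g xi = xi <-> exists2 Q, Q^T *m Q = 1%:M & g *m N = N *m Q).
Proof.
move=> Nxi Gg; have gN := normal_frame_act Gg Nxi; split=> [gxi|[Q QQ e]].
  rewrite gxi in gN; have [QQ e] := normal_frame_unique Nxi gN.
  by exists (N^T *m (g *m N)).
rewrite e in gN; apply: normal_frame_inj gN _.
exact: normal_frame_mul.
Qed.

Lemma diag7_model A e (B : 'M[R]_3) a b :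
  diag7 A e B *m model a b = vec7 (b *: A) 0 (a *: B).
Proof. by rewrite diag7_vec7 !mul_mx_scalar scaler0. Qed.

Lemma model_mul A a b : model a b *m A = vec7 (b *: A) 0 (a *: A).
Proof.
pose Y : 'M[R]_(1 + 3, 3) := col_mx 0 a%:M.
by rewrite [LHS](mul_col_mx (b%:M : 'M[R]_3) Y A) mul_col_mx !mul_scalar_mx mul0mx.
Qed.

(** If g acts on the frame through A, then so does a block diagonal element of G2,
    and by [model_rigid] the two agree.
    When phi does not vanish on the frame, A must have determinant 1; when a = 0,
    the lower block of the diagonal element does not act on the frame, and both
    determinants occur. *)
Lemma model_stabiliser a b (xi : @Gr R 7 4) g : normal_frame (model a b) xi ->
  b * (b ^+ 2 - 3 * a ^+ 2) != 0 -> a = 0 \/ phi3 (model a b) != 0 ->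
  G2 g /\ Gr_act g xi = xi <->
  exists A, [/\ A^T *m A = 1%:M, \det A * phi3 (model a b) = phi3 (model a b) &
    g = diag7 A (\det A) (\det A *: A)].
Proof.
move=> Nxi D ac.
have hM A : \det A * phi3 (model a b) = phi3 (model a b) ->
    diag7 A (\det A) (\det A *: A) *m model a b = model a b *m A.
  move=> dA; rewrite diag7_model model_mul !scalerA; congr vec7.
  case: ac => [->|c0]; first by rewrite mul0r.
  suff -> : \det A = 1 by rewrite mulr1.
  by apply: (mulIf c0); rewrite mul1r.
split=> [[Gg]|[A [AA dA ->]]]; last first.
  split; first exact: diag7_G2.
  by apply/(stabiliser_frame Nxi (diag7_G2 AA)); exists A => //; exact: hM.
move=> /(stabiliser_frame Nxi Gg)[A AA gM]; exists A.
have dA : \det A * phi3 (model a b) = phi3 (model a b).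
  by rewrite -phi3_mul -gM G2_phi3.
split=> //; have Gh := diag7_G2 AA; have := hM A dA; set h := diag7 _ _ _ in Gh *.
move=> hMA; have hU := G2_unit Gh.
have e : invmx h *m g = 1%:M.
  apply: (model_rigid D); first by apply: G2_mul => //; exact: G2_inv.
  by rewrite -mulmxA gM -hMA mulKmx.
by rewrite -[g](mulKVmx hU) e mulmx1.
Qed.

End ModelStabilisers.

(** * Isotropy off the coassociative orbit *)

Section Isotropy.
Context {R : realType}.
Implicit Types (u v w : 'cV[R]_7) (g h k : 'M[R]_7) (N M : 'M[R]_(7, 3)).
Implicit Types (Q : 'M[R]_3) (a b : R) (xi eta : @Gr R 7 4).

Notation act := (@Gr_act R 7 4).

Lemma stabiliser_act P xi g : G2 P ->
  stabiliser (@G2 R) act (act P xi) g <->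
  stabiliser (@G2 R) act xi (invmx P *m g *m P).
Proof.
move=> GP; have GPi := G2_inv GP; have PU := G2_unit GP.
have conj1 : act (invmx P) (act P xi) = xi by rewrite Gr_act_mul // mulVmx // Gr_act1.
split=> -[Gg e].
  have GPg : G2 (invmx P *m g) by exact: G2_mul.
  by split; [exact: G2_mul|rewrite -Gr_act_mul // -Gr_act_mul // e].
have gE : g = P *m ((invmx P *m g *m P) *m invmx P).
  by rewrite mulmxK // mulKVmx.
move: (invmx P *m g *m P) Gg e gE => h Gh e ->.
have Ghi : G2 (h *m invmx P) by exact: G2_mul.
split; first exact: G2_mul.
by rewrite -Gr_act_mul // -Gr_act_mul // conj1 e.
Qed.

(** Conjugation reduces isotropy groups along an orbit to one of its points; both
    directions of the isomorphism are polynomial there, hence smooth. *)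
Lemma stabiliser_iso m (H : set 'M[R]_m) (F : 'M[R]_m -> 'M[R]_7)
    (L : 'M[R]_7 -> 'M[R]_m) P xi :
  G2 P -> polymap F -> polymap L ->
  (forall A, H A -> stabiliser (@G2 R) act xi (F A) /\ L (F A) = A) ->
  (forall g, stabiliser (@G2 R) act xi g -> H (L g) /\ F (L g) = g) ->
  (forall g h, stabiliser (@G2 R) act xi g -> stabiliser (@G2 R) act xi h ->
    L (g *m h) = L g *m L h) ->
  lie_group_iso (stabiliser (@G2 R) act (act P xi)) H.
Proof.
move=> GP pF pL FP LP LM; have PU := G2_unit GP.
exists (fun g => L (invmx P *m g *m P)), (fun A => P *m F A *m invmx P); split.
- move=> g /(stabiliser_act _ _ GP) /LP[HL ->]; split=> //.
  by rewrite !mulmxA mulmxV // mul1mx -mulmxA mulmxV // mulmx1.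
- move=> A /FP[sF LF].
  have e : invmx P *m (P *m F A *m invmx P) *m P = F A.
    by rewrite !mulmxA mulVmx // mul1mx -mulmxA mulVmx // mulmx1.
  by rewrite e; split=> //; apply/(stabiliser_act _ _ GP); rewrite e.
- move=> g1 g2 /(stabiliser_act _ _ GP) s1 /(stabiliser_act _ _ GP) s2.
  by rewrite -LM // !mulmxA mulmxK.
- apply: polymap_smooth_on; apply: (polymap_comp pL).
  by do 2?apply: polymap_mul; do ?[exact: polymap_cst|exact: polymap_id].
- apply: polymap_smooth_on.
  by do 2?apply: polymap_mul; do ?[exact: polymap_cst|exact: polymap_id].
Qed.

(** Up to sign these are the real and the imaginary part of (a + i b)^3; for
    a^2 + b^2 = 1 the conditions say that phi is neither 0 nor 1 nor -1 on the
    frame. *)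
Definition generic a b := phi3 (model a b) != 0 /\ b * (b ^+ 2 - 3 * a ^+ 2) != 0.

Lemma diag_stab_model a b eta Q : Q^T *m Q = 1%:M -> \det Q = 1 ->
  normal_frame (model a b) eta -> stabiliser (@G2 R) act eta (diag7 Q 1 Q).
Proof.
move=> QQ dQ Meta; have G : G2 (diag7 Q 1 Q) by have := diag7_G2 QQ; rewrite dQ scale1r.
split=> //; apply/(stabiliser_frame Meta G); exists Q => //.
by rewrite diag7_model model_mul.
Qed.

Lemma generic_stab a b eta g : generic a b -> normal_frame (model a b) eta ->
  stabiliser (@G2 R) act eta g ->
  exists Q, [/\ Q^T *m Q = 1%:M, \det Q = 1 & g = diag7 Q 1 Q].
Proof.
move=> [c0 D] Meta /(model_stabiliser _ Meta D (or_intror c0))[Q [QQ dQ ->]].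
have {}dQ : \det Q = 1 by apply: (mulIf c0); rewrite mul1r.
by exists Q; rewrite dQ scale1r.
Qed.

Definition block_y g : 'M[R]_3 :=
  drsubmx (drsubmx (g : 'M[R]_(3 + (1 + 3))) : 'M[R]_(1 + 3)).
Definition block_r g : 'M[R]_1 :=
  ulsubmx (drsubmx (g : 'M[R]_(3 + (1 + 3))) : 'M[R]_(1 + 3)).

Lemma block_y_diag7 Q e (B : 'M[R]_3) : block_y (diag7 Q e B) = B.
Proof. by rewrite /block_y /diag7 block_mxKdr block_mxKdr. Qed.

Lemma block_r_diag7 Q e (B : 'M[R]_3) : block_r (diag7 Q e B) = e%:M.
Proof. by rewrite /block_r /diag7 block_mxKdr block_mxKul. Qed.

Lemma polymap_block_y : polymap block_y.
Proof.
move=> i j; under eq_fun do rewrite !mxE.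
exact: polyfun_coord.
Qed.

Lemma polymap_block_r : polymap block_r.
Proof.
move=> i j; under eq_fun do rewrite !mxE.
exact: polyfun_coord.
Qed.

Lemma polymap_diag7 m n (F G : 'M[R]_(m, n) -> 'M[R]_3) (f : 'M[R]_(m, n) -> R) :
  polymap F -> polyfun f -> polymap G ->
  polymap (fun x => diag7 (F x) (f x) (G x)).
Proof.
move=> pF pf pG; apply: (@polymap_block _ _ _ 3 3 (1 + 3) (1 + 3)) => //; try exact: polymap_cst.
apply: polymap_block => //; try exact: polymap_cst.
by move=> i j; under eq_fun do rewrite ord1 (ord1 j) mxE eqxx mulr1n.
Qed.

Lemma generic_isotropy a b P xi : generic a b -> normal_frame (model a b) xi -> G2 P ->
  lie_group_iso (stabiliser (@G2 R) act (act P xi)) (@SO R 3).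
Proof.
move=> gen Nxi GP; have diagP g := @generic_stab a b xi g gen Nxi.
apply: (@stabiliser_iso _ _ (fun A => diag7 A 1 A) block_y) => //.
- by apply: polymap_diag7; do ?[exact: polymap_id|exact: polyfun_cst].
- exact: polymap_block_y.
- move=> A [AA dA]; rewrite block_y_diag7; split=> //.
  by apply: diag_stab_model Nxi; first exact: mulmx1C.
- move=> g /diagP[A [AA dA ->]]; rewrite block_y_diag7; split=> //; split=> //.
  exact: mulmx1C.
- by move=> g h /diagP[A [_ _ ->]] /diagP[B [_ _ ->]]; rewrite diag7_mul !block_y_diag7.
Qed.

Lemma orthZ n e (A : 'M[R]_n) : e * e = 1 -> A^T *m A = 1%:M ->
  (e *: A)^T *m (e *: A) = 1%:M.
Proof.
move=> ee AA; rewrite [(e *: A)^T]linearZ /= -scalemxAl -scalemxAr scalerA ee.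
by rewrite scale1r.
Qed.

(** The stabiliser is O(3), acting by e A, e, A on the three blocks, where e is the
    determinant on the first block and A has determinant 1; the pair A, e is the
    corresponding element of SO(3) x Z_2. *)
Lemma null_isotropy P xi : normal_frame (model 0 1) xi -> G2 P ->
  lie_group_iso (stabiliser (@G2 R) act (act P xi)) (mxgroup_prod (@SO R 3) (@Z2 R)).
Proof.
move=> Nxi GP.
have D : 1 * (1 ^+ 2 - 3 * 0 ^+ 2) != 0 :> R by rewrite expr1n expr0n /= mulr0 subr0 mulr1 oner_neq0.
have c0 : phi3 (model 0 1) = 0 :> R by rewrite phi3_model; ring.
have stabP := model_stabiliser _ Nxi D (or_introl erefl).
have diagP g : stabiliser (@G2 R) act xi g <-> exists e A,
    [/\ e = 1 \/ e = -1, A^T *m A = 1%:M, \det A = 1 & g = diag7 (e *: A) e A].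
  split.
    move=> /stabP[A [AA _ ->]]; have ee := det_orth_sq AA.
    exists (\det A), (\det A *: A); split.
    - have /eqP : \det A ^+ 2 = 1 ^+ 2 by rewrite ee expr1n.
      by rewrite eqf_sqr => /orP[/eqP|/eqP]; [left|right].
    - by apply: orthZ => //; rewrite -expr2.
    - by rewrite detZ -exprSr (exprM _ 2 2) ee expr1n.
    - by rewrite scalerA -expr2 ee scale1r.
  move=> [e [A [e1 AA dA ->]]]; apply/stabP; exists (e *: A).
  have ee : e * e = 1 by case: e1 => ->; rewrite ?mulrNN mulr1.
  have e3 : e ^+ 3 = e by rewrite exprS expr2 ee mulr1.
  split.
  - exact: orthZ.
  - by rewrite c0 mulr0.
  - by rewrite detZ e3 dA mulr1 scalerA ee scale1r.
pose F (M : 'M[R]_(3 + 1)) :=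
  diag7 (drsubmx M 0 0 *: ulsubmx M) (drsubmx M 0 0) (ulsubmx M).
pose L g : 'M[R]_(3 + 1) := block_mx (block_y g) 0 0 (block_r g).
have Z2P e : e = 1 \/ e = -1 -> @Z2 R e%:M.
  by case=> ->; [left|right]; rewrite ?raddfN.
apply: (@stabiliser_iso _ _ F L) => //.
- have pul : polymap (fun M : 'M[R]_(3 + 1) => ulsubmx M).
    by move=> i j; under eq_fun do rewrite !mxE; exact: polyfun_coord.
  have pdr : polyfun (fun M : 'M[R]_(3 + 1) => drsubmx M 0 0).
    by under eq_fun do rewrite !mxE; exact: polyfun_coord.
  by apply: polymap_diag7 => //; exact: polymap_scale.
- apply: polymap_block; do ?exact: polymap_cst.
  + exact: polymap_block_y.
  + exact: polymap_block_r.
- move=> _ [A [B [[AA dA] ZB ->]]].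
  have [e e1 ->] : exists2 e, e = 1 \/ e = -1 & B = e%:M.
    by case: ZB => ->; [exists 1; [left|]|exists (-1); [right|rewrite raddfN]].
  rewrite /F /L block_mxKul block_mxKdr !mxE eqxx mulr1n block_y_diag7 block_r_diag7.
  split=> //; apply/diagP; exists e, A; split=> //; exact: mulmx1C.
- move=> g /diagP[e [A [e1 AA dA ->]]].
  rewrite /F /L block_y_diag7 block_r_diag7 block_mxKul block_mxKdr !mxE eqxx mulr1n.
  split=> //; exists A, e%:M; split=> //; last exact: Z2P.
  by split=> //; exact: mulmx1C.
- move=> g h /diagP[e [A [_ _ _ ->]]] /diagP[e' [A' [_ _ _ ->]]].
  rewrite diag7_mul /L !block_y_diag7 !block_r_diag7 mulmx_block.
  by rewrite !(mul0mx, mulmx0, addr0, add0r) -scalar_mxM.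
Qed.

End Isotropy.

(** * Isotropy of coassociative planes *)

Section CoassociativeIsotropy.
Context {R : realType}.
Implicit Types (u v w : 'cV[R]_7) (g h : 'M[R]_7) (N M : 'M[R]_(7, 3)).
Implicit Types (x y z : 'cV[R]_4) (A : 'M[R]_4) (D : 'M[R]_3) (xi : @Gr R 7 4).

Notation act := (@Gr_act R 7 4).

Definition o4 k : 'I_4 := inord k.

Lemma ord4P (P : 'I_4 -> Prop) :
  P (o4 0) -> P (o4 1) -> P (o4 2) -> P (o4 3) -> forall i, P i.
Proof.
by move=> h0 h1 h2 h3 i; rewrite -(inord_val i); case: i; do 4?[case=> //].
Qed.

Lemma sum4 (V : nmodType) (F : 'I_4 -> V) :
  \sum_i F i = F (o4 0) + F (o4 1) + F (o4 2) + F (o4 3).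
Proof.
by rewrite sum_inord !big_nat_recr //= big_nil add0r.
Qed.

Lemma o7_lshift k : (k < 4)%N -> o7 k = lshift 3 (o4 k).
Proof. by move=> k4; apply: val_inj; rewrite /= !inordK // (ltn_trans k4). Qed.

Lemma o7_rshift k : (k < 3)%N -> o7 (4 + k) = rshift 4 (o3 k).
Proof.
by move=> k3; apply: val_inj; rewrite /= !inordK // -[7%N]/(4 + 3)%N ltn_add2l.
Qed.

(** Vectors of the coassociative plane spanned by x^1, x^2, x^3 and r^0. *)
Definition wvec x : 'cV[R]_7 := col_mx x 0.

Lemma wvecE x k : (k < 4)%N -> wvec x (o7 k) 0 = x (o4 k) 0.
Proof. by move=> k4; rewrite o7_lshift // [LHS]col_mxEu. Qed.

Lemma wvec0 x : [/\ wvec x (o7 4) 0 = 0, wvec x (o7 5) 0 = 0 & wvec x (o7 6) 0 = 0].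
Proof.
by split; [rewrite (@o7_rshift 0)|rewrite (@o7_rshift 1)|rewrite (@o7_rshift 2)];
  rewrite // [LHS]col_mxEd mxE.
Qed.

Definition wblock A D : 'M[R]_7 := block_mx A 0 0 D.

Lemma wblock_wvec A D x : wblock A D *m wvec x = wvec (A *m x).
Proof. by rewrite [LHS](mul_block_col A 0 0 D x 0) !mul0mx !mulmx0 !addr0. Qed.

Lemma dotp_wvec x y : dotp (wvec x) (wvec y) = (x^T *m y) 0 0.
Proof.
have [x4 x5 x6] := wvec0 x.
rewrite /dotp sum7 x4 x5 x6 !mul0r !wvecE // [in RHS]mxE sum4 ![x^T _ _]mxE; ring.
Qed.

Lemma det4 (Q : 'M[R]_4) (q := fun i j => Q (o4 i) (o4 j))
    (m := fun i j k => q i 1%N * (q j 2%N * q k 3%N - q j 3%N * q k 2%N)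
      - q i 2%N * (q j 1%N * q k 3%N - q j 3%N * q k 1%N)
      + q i 3%N * (q j 1%N * q k 2%N - q j 2%N * q k 1%N)) :
  \det Q = q 0%N 0%N * m 1%N 2%N 3%N - q 1%N 0%N * m 0%N 2%N 3%N
    + q 2%N 0%N * m 0%N 1%N 3%N - q 3%N 0%N * m 0%N 1%N 2%N.
Proof.
have -> : Q = \matrix_(i < 4, j < 4) q i j.
  by apply/matrixP => i j; rewrite mxE /q /o4 !inord_val.
rewrite /m; move: q {m} => q.
rewrite (expand_det_row _ ord0) !big_ord_recl big_ord0 /cofactor !(expand_det_row _ ord0).
rewrite !big_ord_recl !big_ord0 /cofactor !(expand_det_row _ ord0).
rewrite !big_ord_recl !big_ord0 /cofactor !det_mx11 !mxE /=.
by rewrite /bump /= ?addn0 ?add0n ?add1n; ring.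
Qed.

Lemma wvec_col7 x :
  wvec x = col7 [:: x (o4 0) 0; x (o4 1) 0; x (o4 2) 0; x (o4 3) 0; 0; 0; 0].
Proof.
have [x4 x5 x6] := wvec0 x.
by apply: eq_col7; apply: ord7P; rewrite [RHS]col7E // ?x4 ?x5 ?x6 ?wvecE.
Qed.

Lemma cross_ww (a0 a1 a2 a3 b0 b1 b2 b3 : R) :
  cross (col7 [:: a0; a1; a2; a3; 0; 0; 0]) (col7 [:: b0; b1; b2; b3; 0; 0; 0]) =
  col7 [:: 0; 0; 0; 0; a3 * b0 - a0 * b3 + (a1 * b2 - a2 * b1);
    a3 * b1 - a1 * b3 + (a2 * b0 - a0 * b2); a3 * b2 - a2 * b3 + (a0 * b1 - a1 * b0)].
Proof.
by apply: eq_col7; apply: ord7P; rewrite [LHS]col7E // [RHS]col7E // !col7E //=; ring.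
Qed.

Lemma cross_wv (a0 a1 a2 a3 y1 y2 y3 : R) :
  cross (col7 [:: a0; a1; a2; a3; 0; 0; 0]) (col7 [:: 0; 0; 0; 0; y1; y2; y3]) =
  col7 [:: a1 * y3 - a3 * y1 - a2 * y2; a2 * y1 - a3 * y2 - a0 * y3;
    a0 * y2 - a3 * y3 - a1 * y1; a0 * y1 + a1 * y2 + a2 * y3; 0; 0; 0].
Proof.
by apply: eq_col7; apply: ord7P; rewrite [LHS]col7E // [RHS]col7E // !col7E //=; ring.
Qed.

(** On orthonormal vectors of the coassociative plane the metric terms vanish, and
    the determinant becomes an expression in cross products. This is why elements
    of G2 restrict to the plane with determinant 1, and why the fourth vector of an
    oriented orthonormal frame is a product of the three others. *)
Lemma dotp_wvec_det A (a := fun i => wvec (col (o4 i) A)) :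
  dotp (a 3) (cross (a 0) (cross (a 1) (a 2))) =
  \det A - dotp (a 0) (a 1) * dotp (a 3) (a 2) + dotp (a 0) (a 2) * dotp (a 3) (a 1).
Proof.
have colE k i : col (o4 k) A i 0 = A i (o4 k) by rewrite mxE.
rewrite /a !wvec_col7 !colE cross_ww cross_wv det4 /dotp !sum7 !col7E //=.
ring.
Qed.

End CoassociativeIsotropy.

Section CoassociativeIsotropy.
Context {R : realType}.
Implicit Types (u v w : 'cV[R]_7) (g h : 'M[R]_7) (N M : 'M[R]_(7, 3)).
Implicit Types (x y z : 'cV[R]_4) (A : 'M[R]_4) (D : 'M[R]_3) (xi : @Gr R 7 4).

Notation act := (@Gr_act R 7 4).

Definition coassoc_frame A (j : 'I_7) : 'cV[R]_7 :=
  let a i := wvec (col (o4 i) A) in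
  nth 0 [:: a 0; a 1; a 2; a 3; cross (a 1) (a 2); cross (a 2) (a 0); cross (a 0) (a 1)] j.

(** The extension of A to R^7: the last three basis vectors are products of
    vectors of the plane, so their images are the products of the images. The
    block so defined is the action on self-dual two-forms. *)
Definition coassoc_mx A : 'M[R]_7 := cols_mx (coassoc_frame A).

Lemma polymap_cross m n (F G : 'M[R]_(m, n) -> 'cV[R]_7) :
  polymap F -> polymap G -> polymap (fun X => cross (F X) (G X)).
Proof.
move=> pF pG i j; rewrite (ord1 j); move: i.
have pM k l : polyfun (fun X => F X (o7 k) 0 * G X (o7 l) 0 - F X (o7 l) 0 * G X (o7 k) 0).
  apply: polyfunD; first exact: polyfunM.
  by under eq_fun do rewrite -mulN1r; apply: polyfunM; [exact: polyfun_cst|exact: polyfunM].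
apply: ord7P; under eq_fun do rewrite col7E //=.
all: exact: (polyfunD (polyfunD (pM _ _) (pM _ _)) (pM _ _)).
Qed.

Lemma polymap_wvec_col j : polymap (fun A => wvec (col j A)).
Proof.
move=> i k; rewrite (ord1 k); case: (split_ordP (i : 'I_(4 + 3))) => l ->.
  suff -> : (fun A => wvec (col j A) (lshift 3 l) 0) = (fun A => A l j).
    exact: polyfun_coord.
  by apply/funext => A; rewrite [LHS]col_mxEu mxE.
suff -> : (fun A => wvec (col j A) (rshift 4 l) 0) = (fun=> 0) by exact: polyfun_cst.
by apply/funext => A; rewrite [LHS]col_mxEd mxE.
Qed.

Lemma polymap_coassoc_mx : polymap coassoc_mx.
Proof.
have pw k := polymap_wvec_col (o4 k).
move=> i j; under eq_fun do rewrite mxE; move: j i.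
by apply: ord7P => i; rewrite /coassoc_frame inordK //=;
  [exact: pw|exact: pw|exact: pw|exact: pw| | |]; apply: polymap_cross; exact: pw.
Qed.

Lemma cross_e7 : [/\ cross (e7 0) (e7 4) = e7 3 :> 'cV[R]_7, cross (e7 1) (e7 2) = e7 4 :> 'cV[R]_7,
  cross (e7 2) (e7 0) = e7 5 :> 'cV[R]_7 & cross (e7 0) (e7 1) = e7 6 :> 'cV[R]_7].
Proof.
by split; apply: eq_col7; apply: ord7P; rewrite [LHS]col7E // !e7E // !col7E //=; ring.
Qed.

End CoassociativeIsotropy.

Section CoassociativeIsotropy.
Context {R : realType}.
Implicit Types (u v w : 'cV[R]_7) (g h : 'M[R]_7) (N M : 'M[R]_(7, 3)).
Implicit Types (x y z : 'cV[R]_4) (A : 'M[R]_4) (D : 'M[R]_3) (xi : @Gr R 7 4).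

Notation act := (@Gr_act R 7 4).

Lemma e7_wvec k : (k < 4)%N -> e7 k = wvec (delta_mx (o4 k) 0) :> 'cV[R]_7.
Proof.
move=> k4; have [x4 x5 x6] := wvec0 (delta_mx (o4 k) 0 : 'cV[R]_4).
apply: eq_col7; apply: ord7P; rewrite ?x4 ?x5 ?x6 ?wvecE // e7E ?(ltn_trans k4) // col7E //.
all: rewrite /= ?mxE -?val_eqE /= ?inordK // ?andbT //.
all: by case: k k4 {x4 x5 x6} => [|[|[|[|]]]].
Qed.

Lemma wblock_e7 A D k : (k < 4)%N -> wblock A D *m e7 k = wvec (col (o4 k) A).
Proof. by move=> k4; rewrite e7_wvec // wblock_wvec -colE. Qed.

Lemma coassoc_mx_block A D : G2 (wblock A D) -> coassoc_mx A = wblock A D.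
Proof.
move=> Gg; have [x04 x12 x20 x01] := @cross_e7 R.
apply: eq_cols; apply: ord7P; rewrite !colE -!/(e7 _) cols_mx_e7 /coassoc_frame inordK //=.
1-4: by rewrite wblock_e7.
- by rewrite -x12 -G2_cross // !wblock_e7.
- by rewrite -x20 -G2_cross // !wblock_e7.
- by rewrite -x01 -G2_cross // !wblock_e7.
Qed.

Lemma wblock_orth A D : G2 (wblock A D) -> A^T *m A = 1%:M.
Proof.
move=> Gg; apply/matrixP => i j.
have dd (B : 'M[R]_4) :
    ((B *m delta_mx i (0 : 'I_1))^T *m (B *m delta_mx j (0 : 'I_1))) 0 0 = (B^T *m B) i j.
  by rewrite -!colE !mxE; apply: eq_bigr => l _; rewrite !mxE.
have := G2_dotp (wvec (delta_mx i 0)) (wvec (delta_mx j 0)) Gg.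
rewrite !wblock_wvec !dotp_wvec dd => ->.
by rewrite -[delta_mx i _]mul1mx -[delta_mx j _]mul1mx dd trmx1 mulmx1.
Qed.

Lemma wblock_det A D : G2 (wblock A D) -> \det A = 1.
Proof.
move=> Gg; have [x04 x12 x20 x01] := @cross_e7 R.
have := dotp_wvec_det A; cbv zeta beta; rewrite -!(@wblock_e7 _ D) //.
rewrite !(G2_cross _ _ Gg) x12 x04 !(G2_dotp _ _ Gg).
have d i j : (i < 7)%N -> (j < 7)%N -> dotp (e7 i) (e7 j) = (i == j)%:R :> R.
  move=> i7 j7; rewrite /dotp (bigD1 (o7 i)) //= big1 ?addr0.
    by rewrite !mxE !eqxx mul1r andbT -val_eqE /= !inordK.
  by move=> l /negbTE li; rewrite !mxE li mul0r.
by rewrite !d //= => e; lra.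
Qed.

(** By [dotp_wvec_det] the fourth column of A is the triple product of the first
    three, so the columns form the adapted frame of the first three. *)
Lemma coassoc_mx_G2 A : A^T *m A = 1%:M -> \det A = 1 -> G2 (coassoc_mx A).
Proof.
move=> AA dA; pose a i := wvec (col (o4 i) A).
have d i j : (i < 4)%N -> (j < 4)%N -> dotp (a i) (a j) = (i == j)%:R.
  move=> i4 j4; rewrite dotp_wvec; have /matrixP/(_ (o4 i) (o4 j)) := AA.
  rewrite !mxE -val_eqE /= !inordK // => <-.
  by apply: eq_bigr => l _; rewrite !mxE.
have e3 : cross (a 0%N) (cross (a 1%N) (a 2)) = a 3.
  apply/eqP; rewrite -subr_eq0; apply/eqP/dotp_eq0.
  have a30 : dotp (a 3) (cross (a 0%N) (cross (a 1%N) (a 2))) = 1.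
    by rewrite dotp_wvec_det dA !d //=; ring.
  have a0x : dotp (a 0%N) (cross (a 1%N) (a 2)) = 0.
    rewrite /a !wvec_col7 cross_ww /dotp sum7 !col7E //=; ring.
  rewrite dotpDl !dotpDr !dotpNl !dotpNr [dotp (cross _ _) (a 3)]dotpC a30.
  by rewrite !dotp_cross_cross a0x !d //=; ring.
have GP : G2 (cols_mx (adapted_frame (a 0%N) (a 1%N) (a 2))).
  apply: adapted_frame_G2; rewrite ?d //.
  by rewrite phi_cross /a !wvec_col7 cross_ww /dotp sum7 !col7E //=; ring.
suff -> : coassoc_mx A = cols_mx (adapted_frame (a 0%N) (a 1%N) (a 2)) by [].
apply: eq_cols; apply: ord7P; rewrite !colE -!/(e7 _) !cols_mx_e7.
all: by rewrite /coassoc_frame /adapted_frame !inordK //=.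
Qed.

Lemma coassoc_mx_wblock A : A^T *m A = 1%:M -> \det A = 1 ->
  exists D, coassoc_mx A = wblock A D.
Proof.
move=> AA dA; pose g : 'M[R]_(4 + 3) := coassoc_mx A.
exists (drsubmx g); rewrite -[LHS](submxK g) /wblock.
have gE i j : g i j = coassoc_frame A j i 0 by rewrite mxE.
have ul : ulsubmx g = A.
  apply/matrixP => i j; transitivity (g (lshift 3 i) (lshift 3 j)); first by rewrite !mxE.
  rewrite gE; move: j.
  by apply: ord4P; rewrite -o7_lshift // /coassoc_frame inordK //= [LHS]col_mxEu mxE.
have dl : dlsubmx g = 0.
  apply/matrixP => i j; transitivity (g (rshift 4 i) (lshift 3 j)); first by rewrite !mxE.
  rewrite gE [RHS]mxE; move: j.
  by apply: ord4P; rewrite -o7_lshift // /coassoc_frame inordK //= [LHS]col_mxEd mxE.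
have ur : ursubmx g = 0.
  apply/matrixP => i j; transitivity (g (lshift 3 i) (rshift 4 j)); first by rewrite !mxE.
  rewrite gE [RHS]mxE; move: j.
  by apply: ord3P; rewrite -o7_rshift // /coassoc_frame inordK //= !wvec_col7 cross_ww;
    move: i; apply: ord4P; rewrite -o7_lshift // col7E.
by rewrite ul dl ur.
Qed.

Lemma model10 : model 1 0 = col_mx (0 : 'M[R]_(4, 3)) 1%:M :> 'M[R]_(4 + 3, 3).
Proof.
have [c0 c1 c2] := @col_model R 1 0.
have e (M : 'M[R]_(7, 3)) i j : M i j = col j M i 0 by rewrite mxE.
apply/matrixP => i j; case: (split_ordP i) => k ->.
  rewrite col_mxEu [RHS]mxE; move: j k.
  by apply: ord3P; apply: ord4P; rewrite -o7_lshift // [LHS]e ?c0 ?c1 ?c2 col7E.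
rewrite col_mxEd [RHS]mxE; move: j k.
by apply: ord3P; apply: ord3P; rewrite -o7_rshift // [LHS]e ?c0 ?c1 ?c2 col7E // -val_eqE /= !inordK.
Qed.

(** Preserving the normal space kills one off-diagonal block, orthogonality the
    other one. *)
Lemma coassoc_stabiliser xi g : normal_frame (model 1 0) xi ->
  stabiliser (@G2 R) act xi g <-> G2 g /\ exists A D, g = wblock A D.
Proof.
move=> Nxi; split=> -[Gg]; last first.
  move=> [A [D gE]]; split=> //; apply/(stabiliser_frame Nxi Gg).
  have gM : g *m model 1 0 = model 1 0 *m D.
    rewrite model10 gE [RHS](mul_col_mx (0 : 'M[R]_(4, 3)) 1%:M D).
    rewrite [LHS](mul_block_col A 0 0 D (0 : 'M[R]_(4, 3)) 1%:M).
    by rewrite !mulmx0 !mul0mx !addr0 !add0r mul1mx mulmx1.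
  exists D => //; have [MM _] := Nxi; have [] := normal_frame_act Gg Nxi.
  rewrite gM trmx_mul mulmxA -[_ *m _ *m model 1 0]mulmxA MM mulmx1 => //.
move=> /(stabiliser_frame Nxi Gg)[Q QQ]; split=> //.
pose g' : 'M[R]_(4 + 3) := g; pose A := ulsubmx g'; pose B := ursubmx g'.
pose C := dlsubmx g'; pose D := drsubmx g'.
have gE : g = block_mx A B C D :> 'M[R]_(4 + 3) by rewrite submxK.
have [B0 DQ] : B = 0 /\ D = Q.
  have : g *m model 1 0 = model 1 0 *m Q by [].
  rewrite model10 gE [RHS](mul_col_mx (0 : 'M[R]_(4, 3)) 1%:M Q).
  rewrite [LHS](mul_block_col A B C D (0 : 'M[R]_(4, 3)) 1%:M).
  by rewrite !mulmx0 !mul0mx !add0r mul1mx !mulmx1 => e; exact: (@eq_col_mx R 4 3 3 B D 0 Q e).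
have C0 : C = 0.
  have gg : (block_mx A B C D)^T *m block_mx A B C D = 1%:M.
    by rewrite -gE; exact: G2_tr_mul.
  move: gg; rewrite tr_block_mx mulmx_block (@scalar_mx_block R 4 3).
  move=> e; have [_ CD _ _] := eq_block_mx e; move: CD.
  rewrite B0 DQ mulmx0 add0r => /(congr1 (mulmxr Q^T)) /=.
  by rewrite -mulmxA (mulmx1C QQ) mulmx1 mul0mx => /(congr1 trmx); rewrite trmxK trmx0.
by exists A, D; rewrite gE B0 C0.
Qed.

Lemma coassoc_isotropy P xi : normal_frame (model 1 0) xi -> G2 P ->
  lie_group_iso (stabiliser (@G2 R) act (act P xi)) (@SO R 4).
Proof.
move=> Nxi GP; pose L g : 'M[R]_4 := ulsubmx (g : 'M[R]_(4 + 3)).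
have LE A D : L (wblock A D) = A by rewrite /L /wblock block_mxKul.
apply: (@stabiliser_iso _ _ _ coassoc_mx L) => //.
- exact: polymap_coassoc_mx.
- by move=> i j; under eq_fun do rewrite !mxE; exact: polyfun_coord.
- move=> A [AA dA]; have {}AA := mulmx1C AA.
  have [D e] := coassoc_mx_wblock AA dA; rewrite {2}e LE; split=> //.
  apply/(coassoc_stabiliser _ Nxi); split; first exact: coassoc_mx_G2.
  by exists A, D.
- move=> g /(coassoc_stabiliser _ Nxi)[Gg [A [D gE]]]; rewrite gE in Gg *; rewrite LE.
  split; last exact: coassoc_mx_block.
  by split; [exact/mulmx1C/(wblock_orth Gg)|exact: wblock_det Gg].
- move=> g h /(coassoc_stabiliser _ Nxi)[_ [A [D ->]]] /(coassoc_stabiliser _ Nxi)[_ [A' [D' ->]]].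
  have -> : wblock A D *m wblock A' D' = wblock (A *m A') (D *m D').
    rewrite [LHS](mulmx_block A 0 0 D A' 0 0 D').
    by rewrite !mulmx0 !mul0mx !addr0 !add0r.
  by rewrite !LE.
Qed.

End CoassociativeIsotropy.

(** * Generic orbits are hypersurfaces *)

Section Codimension.
Context {R : realType}.
Implicit Types (u v w : 'cV[R]_7) (g h : 'M[R]_7) (N M : 'M[R]_(7, 3)).
Implicit Types (a b : R) (xi eta : @Gr R 7 4) (A : 'M[R]_(3, 4)).

Notation act := (@Gr_act R 7 4).

Lemma vec7_tr_mul p q (x y : 'M[R]_(3, p)) r (x' y' : 'M[R]_(3, q)) r' :
  (vec7 x r y)^T *m vec7 x' r' y' = x^T *m x' + (r^T *m r' + y^T *m y').
Proof.
pose X := col_mx r y; pose X' := col_mx r' y'.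
rewrite (tr_col_mx x X : (vec7 x r y)^T = _) tr_col_mx.
by rewrite [LHS](mul_row_col x^T (row_mx r^T y^T) x' X') mul_row_col.
Qed.

Lemma model_tr_mul a b a' b' :
  (model a b)^T *m model a' b' = (a * a' + b * b')%:M.
Proof.
rewrite /model vec7_tr_mul !tr_scalar_mx mulmx0 add0r -!scalar_mxM -raddfD.
by rewrite addrC.
Qed.

(** A frame of the plane normal to the model frame: the frame of i (a + i b) R^3
    and the vector r_0. Its first block points in the direction in which the model
    rotates. *)
Definition tangent_frame a b : 'M[R]_(7, 4) := row_mx (model (- b) a) (vec7 0 1%:M 0).

Lemma tangent_frame_orth a b : a ^+ 2 + b ^+ 2 = 1 ->
  (tangent_frame a b)^T *m tangent_frame a b = 1%:M /\
  (tangent_frame a b)^T *m model a b = 0.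
Proof.
move=> ab; rewrite /tangent_frame.
have [T X] : (model (- b) a)^T *m model (- b) a = 1%:M /\ (model (- b) a)^T *m model a b = 0.
  rewrite !model_tr_mul; split; last by rewrite (_ : - b * a + a * b = 0) ?raddf0 //; ring.
  by congr (_%:M); rewrite -ab; ring.
have E0 (c d : R) : (model c d)^T *m vec7 (0 : 'cV_3) 1%:M 0 = 0.
  by rewrite /model vec7_tr_mul !mulmx0 trmx0 mul0mx !addr0.
have E1 (c d : R) : (vec7 (0 : 'cV_3) 1%:M 0)^T *m model c d = 0.
  by rewrite /model vec7_tr_mul !trmx0 !mul0mx mulmx0 !addr0.
have E2 : (vec7 (0 : 'cV_3) 1%:M 0)^T *m vec7 (0 : 'cV_3) 1%:M 0 = 1%:M :> 'M[R]_1.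
  by rewrite vec7_tr_mul !trmx0 !mul0mx trmx1 mulmx1 add0r addr0.
move: E0 E1 E2 => /(_ (- b) a); set e := vec7 0 1%:M 0 => E0 E1 E2.
rewrite (tr_row_mx (model (- b) a) e : (row_mx _ _)^T = _); split.
  rewrite [LHS](mul_col_row (model (- b) a)^T e^T (model (- b) a) e).
  by rewrite T E0 E1 E2 -scalar_mx_block.
by rewrite [LHS](mul_col_mx (model (- b) a)^T e^T (model a b)) X E1 col_mx0.
Qed.

Lemma frame_complete (B : 'M[R]_(7, 4)) (C : 'M[R]_(7, 3)) :
  B^T *m B = 1%:M -> C^T *m C = 1%:M -> B^T *m C = 0 -> B *m B^T + C *m C^T = 1%:M.
Proof.
move=> BB CC BC; pose X : 'M[R]_(7, 4 + 3) := row_mx B C.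
have CB : C^T *m B = 0 by rewrite -[C^T *m B]trmxK trmx_mul trmxK BC trmx0.
have : X^T *m X = 1%:M by rewrite /X tr_row_mx mul_col_row BB CC BC CB -scalar_mx_block.
by move=> e; rewrite -(mul_row_col B C B^T C^T) -tr_row_mx; exact: (@mulmx1C _ 7 _ _ e).
Qed.

(** In the chart at a plane with frame B and normal frame C, the plane spanned by
    B + C A has normal frame C - B A^T. *)
Lemma colspan_perp (B : 'M[R]_(7, 4)) (C : 'M[R]_(7, 3)) A :
  B^T *m B = 1%:M -> C^T *m C = 1%:M -> B^T *m C = 0 ->
  colspan (B + C *m A) = perp (C - B *m A^T).
Proof.
move=> BB CC BC; have full := frame_complete BB CC BC.
have CB : C^T *m B = 0 by rewrite -[C^T *m B]trmxK trmx_mul trmxK BC trmx0.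
apply/vspaceP => v; rewrite mem_perp linearB /= trmx_mul trmxK.
apply/memv_imgP/eqP => [[x _ ->]|e].
  rewrite lfunE /= mulmxA mulmxBl !mulmxDr -!mulmxA [C^T *m (C *m A)]mulmxA.
  by rewrite CC [B^T *m (C *m A)]mulmxA BC BB CB mul0mx mulmx0 mulmx1 mul1mx add0r addr0 subrr mul0mx.
exists (B^T *m v); rewrite ?memvf // lfunE /= mulmxDl -mulmxA.
move/eqP: e; rewrite mulmxBl subr_eq0 => /eqP e.
by rewrite [A *m _]mulmxA -e !mulmxA -mulmxDl full mul1mx.
Qed.

Lemma vec7D p (x y : 'M[R]_(3, p)) r (x' y' : 'M[R]_(3, p)) r' :
  vec7 x r y + vec7 x' r' y' = vec7 (x + x') (r + r') (y + y').
Proof.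
pose Y := col_mx r y; pose Y' := col_mx r' y'.
by rewrite [LHS](add_col_mx x Y x' Y') add_col_mx.
Qed.

Lemma vec7Z p (s : R) (x y : 'M[R]_(3, p)) r :
  s *: vec7 x r y = vec7 (s *: x) (s *: r) (s *: y).
Proof. by pose Y := col_mx r y; rewrite [LHS](scale_col_mx s x Y) scale_col_mx. Qed.

Lemma model_rotate a b s : model a b - s *: model (- b) a = model (a + s * b) (b - s * a).
Proof.
rewrite -scaleNr /model vec7Z vec7D !scale_scalar_mx scaler0 addr0 -!raddfD /=.
by rewrite mulNr mulrNN.
Qed.

Lemma tangent_frame_mul a b s :
  tangent_frame a b *m (s *: (row_mx 1%:M 0 : 'M[R]_(3, 3 + 1)))^T = s *: model (- b) a.
Proof.
rewrite linearZ /= -scalemxAr (tr_row_mx (1%:M : 'M[R]_3) (0 : 'cV[R]_3)).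
by rewrite (mul_row_col (model (- b) a) _ 1%:M^T 0^T) trmx1 mulmx1 trmx0 mulmx0 addr0.
Qed.

(** The derivative at 0 depends only on the restriction of f to a line, here a
    polynomial function. *)
Lemma derive_horner_line (V : normedModType R) (f : V -> R) (v : V) (p : {poly R}) :
  (forall s : R, f (s *: v) = p.[s]) -> 'D_v f 0 = p^`().[0].
Proof.
move=> fp; have f0 : f 0 = p.[0] by rewrite -fp scale0r.
have <- : derive1 (horner p) 0 = p^`().[0] by rewrite derive1E derive_val.
rewrite derive1E /derive.
suff -> : (fun h : R => h^-1 *: (f (h *: v + 0) - f 0)) =
    (fun h : R => h^-1 *: (p.[h *: 1 + 0] - p.[0])) by [].
by apply/funext => h /=; rewrite !addr0 f0 fp [h *: 1]mulr1.
Qed.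

(** The equation of the orbit in the chart, restricted to the direction in which
    the frame rotates from (a, b) towards (b, - a). *)
Definition rotation_poly a b c t : {poly R} :=
  let x := a%:P + (t * b) *: 'X in let y := b%:P - (t * a) *: 'X in
  let f := 3%:P * (x * (y * y)) - x * (x * x) in
  let q := x * x + y * y in
  f * f - (c ^+ 2)%:P * (q * (q * q)).

Lemma rotation_polyE a b c t s (x := a + s * t * b) (y := b - s * t * a) :
  (rotation_poly a b c t).[s] =
  (3 * x * y ^+ 2 - x ^+ 3) ^+ 2 - c ^+ 2 * (x * x + y * y) ^+ 3.
Proof.
rewrite /rotation_poly !(hornerD, hornerN, hornerM, hornerZ, hornerX, hornerC) /x /y.
ring.
Qed.

(** The derivative of the square of the real part of (a + i b)^3 in the direction of
    rotation; the factor a^2 + b^2 is stationary. *)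
Lemma rotation_poly_deriv a b c t : (rotation_poly a b c t)^`().[0] =
  6 * (3 * a * b ^+ 2 - a ^+ 3) * (b * (b ^+ 2 - 3 * a ^+ 2)) * t.
Proof.
rewrite /rotation_poly.
rewrite !(derivB, derivD, derivN, derivM, derivZ, derivX, derivC).
rewrite !(hornerD, hornerN, hornerM, hornerZ, hornerX, hornerC).
ring.
Qed.

(** The normal frame C - B A^T is not orthonormal, so its Gram determinant enters
    the equation. *)
Definition chart_eq (c : R) (B : 'M[R]_(7, 4)) (C : 'M[R]_(7, 3)) A : R :=
  phi3 (C - B *m A^T) ^+ 2 - c ^+ 2 * \det ((C - B *m A^T)^T *m (C - B *m A^T)).

Lemma chart_eq_polyfun c B C : polyfun (chart_eq c B C).
Proof.
have pN : polymap (fun A => C - B *m A^T).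
  apply: polymap_add; first exact: polymap_cst.
  apply: polymap_opp; apply: polymap_mul; first exact: polymap_cst.
  by apply: polymap_tr; exact: polymap_id.
have pc j : polymap (fun A => col j (C - B *m A^T)).
  by move=> i k; under eq_fun do rewrite mxE; exact: pN.
have pp : polyfun (fun A => phi3 (C - B *m A^T)).
  rewrite /phi3; under eq_fun do rewrite phi_cross.
  apply: polyfun_sum => i; apply: polyfunM; last exact: pc.
  by apply: (polymap_cross (pc _) (pc _)).
rewrite /chart_eq; under eq_fun do rewrite expr2 -[- (_ * _)]mulNr.
apply: polyfunD; apply: polyfunM => //; first exact: polyfun_cst.
by apply: polyfun_det; apply: polymap_mul => //; exact: polymap_tr.
Qed.

(** The orbit is the level set of phi3^2, which in the chart is a polynomial
    equation; its differential is not zero in the direction of rotation. *)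
Lemma orbit_codim1 a b xi : a ^+ 2 + b ^+ 2 = 1 -> generic a b ->
  normal_frame (model a b) xi ->
  Gr_submanifold_codim 1 (orbit_of (@G2 R) act xi).
Proof.
move=> ab [c0 D] Mxi eta [g0 Gg <-] {eta}; set M := model a b in c0 Mxi.
pose B : 'M[R]_(7, 4) := g0 *m tangent_frame a b.
pose C : 'M[R]_(7, 3) := g0 *m M.
have [TT TM] := tangent_frame_orth ab; have [MM _] := Mxi.
have gg := G2_tr_mul Gg.
have conj p q (X : 'M[R]_(7, p)) (Y : 'M[R]_(7, q)) : (g0 *m X)^T *m (g0 *m Y) = X^T *m Y.
  by rewrite trmx_mul mulmxA -[_ *m _ *m g0]mulmxA gg mulmx1.
have BB : B^T *m B = 1%:M by rewrite conj.
have CC : C^T *m C = 1%:M by rewrite conj.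
have BC : B^T *m C = 0 by rewrite conj.
have full := frame_complete BB CC BC.
have CB : C^T *m B = 0 by rewrite -[C^T *m B]trmxK trmx_mul trmxK BC trmx0.
exists B, C; split.
- have [_ ->] := normal_frame_act Gg Mxi; rewrite -/C.
  have := colspan_perp 0 BB CC BC; rewrite mulmx0 addr0 => ->.
  by rewrite trmx0 mulmx0 subr0.
- apply/row_freeP; exists (col_mx B^T C^T).
  by rewrite mul_row_col.
exists setT, (fun _ : 'I_1 => chart_eq (phi3 M) B C); split=> //.
- exact: openT.
- by move=> _; apply: polyfun_smooth; exact: chart_eq_polyfun.
- move=> y; pose d := 6 * phi3 M * (b * (b ^+ 2 - 3 * a ^+ 2)).
  have d0 : d != 0 by apply: mulf_neq0 => //; apply: mulf_neq0 => //; rewrite pnatr_eq0.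
  (* d is the derivative in the direction of rotation with unit speed *)
  pose t := y 0 / d.
  exists (t *: (row_mx 1%:M 0 : 'M[R]_(3, 3 + 1))) => i.
  rewrite (@derive_horner_line _ _ _ (rotation_poly a b (phi3 M) t)).
    by rewrite rotation_poly_deriv -phi3_model (ord1 i) -/M -/d mulrC divfK.
  move=> s; rewrite scalerA.
  have NE : C - B *m ((s * t) *: (row_mx 1%:M 0 : 'M[R]_(3, 3 + 1)))^T
      = g0 *m model (a + s * t * b) (b - s * t * a).
    by rewrite /B -mulmxA tangent_frame_mul -mulmxBr model_rotate.
  rewrite /chart_eq NE G2_phi3 // conj model_tr_mul det_scalar phi3_model.
  by rewrite rotation_polyE.
have key A eta : val eta = colspan (B + C *m A) ->
    (orbit_of (@G2 R) act xi eta <-> chart_eq (phi3 M) B C A = 0).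
  move=> etaE; rewrite colspan_perp // in etaE.
  have [N Neta] := exists_normal_frame eta.
  have := perp_factor Neta etaE; set Q := N^T *m _ => NQ.
  have dQ : \det Q != 0.
    have : C^T *m N *m Q = 1%:M.
      by rewrite -mulmxA -NQ mulmxBr CC mulmxA CB mul0mx subr0.
    move=> /(congr1 determinant); rewrite det_mulmx det1 => e.
    by apply/negP => /eqP Q0; move: e; rewrite Q0 mulr0 => /eqP; rewrite eq_sym oner_eq0.
  have -> : chart_eq (phi3 M) B C A = \det Q ^+ 2 * (phi3 N ^+ 2 - phi3 M ^+ 2).
    rewrite /chart_eq NQ phi3_mul trmx_mul -mulmxA [N^T *m _]mulmxA (proj1 Neta).
    by rewrite mul1mx det_mulmx det_tr; ring.
  have orbP := same_orbitP Neta Mxi.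
  split=> [[h Gh hxi]|/eqP].
    by apply/eqP; rewrite mulf_eq0 subr_eq0; apply/orP; right; apply/eqP/orbP; exists h.
  rewrite mulf_eq0 expf_eq0 (negbTE dQ) /= subr_eq0 => /eqP /orbP[h Gh hxi].
  by exists h.
move=> A _; split=> [[eta Oeta etaE]|A0]; first by move=> _; apply/(key _ _ etaE).
have dimA : \dim (colspan (B + C *m A)) == 4.
  rewrite limg_dim_eq ?dim_cV //.
  suff -> : lker (linfun (mulmx (B + C *m A) : 'cV[R]_4 -> 'cV[R]_7)) = 0%VS by rewrite capv0.
  apply/eqP/lker0P => u v; rewrite !lfunE /= => /(congr1 (mulmx B^T)).
  by rewrite !mulmxA mulmxDr BB mulmxA BC mul0mx addr0 !mul1mx.
exists (exist (fun U : {vspace 'cV[R]_7} => \dim U == 4) _ dimA) => //.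
by apply/key => //; exact: (A0 0).
Qed.

End Codimension.

(** * Orbits and principal points *)

Section Classification.
Context {R : realType}.
Implicit Types (u v w : 'cV[R]_7) (g h : 'M[R]_7) (N M : 'M[R]_(7, 3)).
Implicit Types (a b : R) (xi eta : @Gr R 7 4).

Notation act := (@Gr_act R 7 4).
Notation stab := (stabiliser (@G2 R) act).
Notation orbit := (orbit_of (@G2 R) act).
Notation principal := (principal_point (@G2 R) act).

(** With b^2 = 1 - a^2 the value 3 a b^2 - a^3 is 3 a - 4 a^3, which takes the
    values 1 at a = -1 and -1 at a = 1. *)
Lemma exists_model_angle (c : R) : c ^+ 2 <= 1 ->
  exists a b, a ^+ 2 + b ^+ 2 = 1 /\ phi3 (model a b) = c.
Proof.
move=> c2; have /andP[c_ge c_le] : -1 <= c <= 1 by apply/andP; split; nra.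
pose p : {poly R} := 4%:P * ('X * ('X * 'X)) - 3%:P * 'X + c%:P.
have pE x : p.[x] = 4 * x ^+ 3 - 3 * x + c.
  by rewrite /p !(hornerD, hornerN, hornerM, hornerX, hornerC); ring.
have [a /andP[a_ge a_le] /rootP] : exists2 a, -1 <= a <= 1 & root p a.
  apply: poly_ivt; first by lra.
  by rewrite !pE; apply/andP; split; lra.
rewrite pE => ac; pose b := Num.sqrt (1 - a ^+ 2).
have b2 : b ^+ 2 = 1 - a ^+ 2 by rewrite sqr_sqrtr // subr_ge0; nra.
exists a, b; split; first by rewrite b2; ring.
rewrite phi3_model b2; lra.
Qed.

(** The square modulus of (a + i b)^3. *)
Lemma model_norm a b : a ^+ 2 + b ^+ 2 = 1 ->
  phi3 (model a b) ^+ 2 + (b * (b ^+ 2 - 3 * a ^+ 2)) ^+ 2 = 1.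
Proof.
move=> ab; transitivity ((a ^+ 2 + b ^+ 2) ^+ 3); last by rewrite ab expr1n.
by rewrite phi3_model; ring.
Qed.

Lemma exists_model_point a b : a ^+ 2 + b ^+ 2 = 1 ->
  exists xi, normal_frame (model a b) xi.
Proof. by move=> ab; apply: normal_frame_Gr; exact: model_orth. Qed.

Lemma orbit_refl xi : orbit xi xi.
Proof. by exists 1%:M; [exact: G2_1|exact: Gr_act1]. Qed.

Lemma orbit_eq xi eta : orbit xi eta -> orbit eta = orbit xi.
Proof.
move=> [g Gg <-]; apply/seteqP; split=> zeta [h Gh <-].
  by exists (h *m g); [exact: G2_mul|rewrite Gr_act_mul].
exists (h *m invmx g); first by apply: G2_mul => //; exact: G2_inv.
rewrite Gr_act_mul //; last by apply: G2_mul => //; exact: G2_inv.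
by rewrite mulmxKV // G2_unit.
Qed.

Lemma model_point_orbit N xi a b eta : normal_frame N xi -> normal_frame (model a b) eta ->
  phi3 N ^+ 2 = phi3 (model a b) ^+ 2 -> orbit eta xi.
Proof. by move=> Nxi Meta /(same_orbitP Nxi Meta) [g Gg e]; exists g. Qed.

Lemma model_exhaustive xi : exists a b eta,
  [/\ a ^+ 2 + b ^+ 2 = 1, normal_frame (model a b) eta & orbit eta xi].
Proof.
have [N Nxi] := exists_normal_frame xi.
have [a [b [ab e]]] := exists_model_angle (phi3_le1 Nxi.1).
have [eta Meta] := exists_model_point ab.
by exists a, b, eta; split=> //; apply: model_point_orbit Nxi Meta _; rewrite e.
Qed.

Lemma generic_rational : generic (3 / 5 : R) (4 / 5).
Proof.
split; first by rewrite phi3_model; apply/negP => /eqP; lra.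
by apply/negP => /eqP; lra.
Qed.

Lemma model_trichotomy xi : [\/ exists2 eta, normal_frame (model 1 0) eta & orbit eta xi,
  exists2 eta, normal_frame (model 0 1) eta & orbit eta xi |
  exists a b eta, [/\ a ^+ 2 + b ^+ 2 = 1, generic a b, normal_frame (model a b) eta &
    orbit eta xi]].
Proof.
have [N Nxi] := exists_normal_frame xi.
have [c0|c0] := eqVneq (phi3 N) 0.
  have [|eta Meta] := @exists_model_point 0 1; first by ring.
  apply: Or32; exists eta => //; apply: model_point_orbit Nxi Meta _.
  by rewrite c0 phi3_model; ring.
have [c1|c1] := eqVneq (phi3 N ^+ 2) 1.
  have [|eta Meta] := @exists_model_point 1 0; first by ring.
  apply: Or31; exists eta => //; apply: model_point_orbit Nxi Meta _.
  by rewrite c1 phi3_model; ring.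
have [a [b [ab e]]] := exists_model_angle (phi3_le1 Nxi.1).
have [eta Meta] := exists_model_point ab.
apply: Or33; exists a, b, eta; split=> //; last first.
  by apply: model_point_orbit Nxi Meta _; rewrite e.
split; first by rewrite e.
apply/eqP => D; have := model_norm ab; rewrite D e => /eqP.
by rewrite expr0n addr0 (negbTE c1).
Qed.

Lemma invmxM g h : g \in unitmx -> h \in unitmx -> invmx (g *m h) = invmx h *m invmx g.
Proof.
move=> gU hU; have ghU : g *m h \in unitmx by rewrite unitmx_mul gU.
rewrite -[RHS]mulmx1 -(mulmxV ghU) !mulmxA -[_ *m _ *m g]mulmxA mulVmx //.
by rewrite mulmx1 mulVmx // mul1mx.
Qed.

(** After conjugation the stabiliser of a generic plane is the group of all
    diag7 Q 1 Q, which stabilises every model plane. *)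
Lemma generic_principal a b eta xi : generic a b -> normal_frame (model a b) eta ->
  orbit eta xi -> principal xi.
Proof.
move=> gen Meta [P GP <-] {xi} y.
have [a' [b' [eta' [_ Meta' [Q GQ <-]]]]] := model_exhaustive y.
have PU := G2_unit GP; have QU := G2_unit GQ.
have GPi := G2_inv GP.
exists (Q *m invmx P); first exact: G2_mul.
move=> h /(stabiliser_act _ _ GP) /(generic_stab gen Meta)[A [AA dA hE]].
apply/(stabiliser_act _ _ GQ); rewrite invmxM ?unitmx_inv // invmxK !mulmxA.
rewrite mulVmx // mul1mx -!mulmxA mulVmx // mulmx1 mulmxA hE.
exact: diag_stab_model Meta'.
Qed.

(** The planes stable under the group K of the matrices diag7 Q e (e Q), with Q
    orthogonal of determinant e; K is larger than the generic isotropy. *)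
Definition stab_all_diag xi := forall Q, Q^T *m Q = 1%:M ->
  stab xi (diag7 Q (\det Q) (\det Q *: Q)).

Lemma coassoc_stab_diag eta : normal_frame (model 1 0) eta -> stab_all_diag eta.
Proof.
move=> Meta Q QQ; have G := diag7_G2 QQ; split=> //.
apply/(stabiliser_frame Meta G); exists (\det Q *: Q).
  by apply: orthZ => //; rewrite -expr2 det_orth_sq.
by rewrite diag7_model model_mul !scale0r.
Qed.

Lemma null_stab_diag eta : normal_frame (model 0 1) eta -> stab_all_diag eta.
Proof.
move=> Meta Q QQ; have G := diag7_G2 QQ; split=> //.
by apply/(stabiliser_frame Meta G); exists Q => //; rewrite diag7_model model_mul !scale0r.
Qed.

(** Sign changes already suffice: - 1 leaves only the last block, and the two
    other sign patterns leave nothing there. *)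
Lemma diag_no_fixed_vector w :
  (forall Q, Q^T *m Q = 1%:M -> diag7 Q (\det Q) (\det Q *: Q) *m w = w) -> w = 0.
Proof.
have [x [r [y ->]]] := vec7_split w => K.
have eqv (x' y' : 'cV[R]_3) (r' : 'cV[R]_1) :
    vec7 x' r' y' = vec7 x r y -> [/\ x' = x, r' = r & y' = y].
  move=> e; have [-> e'] := @eq_col_mx _ 3 (1 + 3) 1 _ _ _ _ e.
  by have [-> ->] := eq_col_mx e'.
have half (V : lmodType R) (z : V) : - z = z -> z = 0.
  move=> e; have : 2%:R *: z = 0 by rewrite scaler_nat mulr2n -{1}e addNr.
  by move=> /eqP; rewrite scaler_eq0 pnatr_eq0 => /eqP.
pose d (s : seq R) : 'M[R]_3 := diag_mx (\row_j s`_j).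
have dd s : all (fun t => t ^+ 2 == 1) s -> size s = 3 -> (d s)^T *m d s = 1%:M.
  move=> sP s3; rewrite tr_diag_mx mulmx_diag; apply/matrixP => i j; rewrite !mxE.
  case: eqP => // ->; rewrite mulr1n -expr2; apply/eqP.
  by apply: (allP sP); rewrite mem_nth // s3.
have det_d s : \det (d s) = s`_0 * s`_1 * s`_2.
  by rewrite det_diag big_ord_recl !big_ord_recl big_ord0 !mxE /= mulr1 mulrA.
have dE s (z : 'cV[R]_3) i : (d s *m z) i 0 = s`_i * z i 0.
  by rewrite mul_diag_mx !mxE.
have Ks (s0 s1 s2 : R) : all (fun t => t ^+ 2 == 1) [:: s0; s1; s2] ->
    let e := s0 * s1 * s2 in
    [/\ d [:: s0; s1; s2] *m x = x, e *: r = r & (e *: d [:: s0; s1; s2]) *m y = y].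
  move=> sP e; apply: eqv; rewrite -diag7_vec7.
  by have := K _ (dd _ sP erefl); rewrite det_d.
have sqN1 : (-1) ^+ 2 == 1 :> R by rewrite sqrrN expr1n.
have sq1 : 1 ^+ 2 == 1 :> R by rewrite expr1n.
have [] := Ks (-1) (-1) (-1); first by rewrite /= sqN1.
have [] := Ks 1 (-1) (-1); first by rewrite /= sqN1 sq1.
have [] := Ks (-1) (-1) 1; first by rewrite /= sqN1 sq1.
rewrite !(mulrNN, mul1r, mulr1) !scale1r !scaleN1r => _ _ y0 _ _ y1 x0 /half -> _.
have signE s (z : 'cV[R]_3) (i : 'I_3) : d s *m z = z -> s`_i = -1 -> z i 0 = 0.
  by move=> e si; have := dE s z i; rewrite e si => {}e; lra.
have xE i : x i 0 = 0 by apply: (signE _ _ _ x0); case: i => -[|[|[|]]].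
have -> : x = 0 by apply/matrixP => i j; rewrite (ord1 j) xE mxE.
have -> : y = 0.
  apply/matrixP => i j; rewrite (ord1 j) mxE; move: i; apply: ord3P.
  - by apply: (signE _ _ _ y0); rewrite inordK.
  - by apply: (signE _ _ _ y0); rewrite inordK.
  - by apply: (signE _ _ _ y1); rewrite inordK.
by rewrite /vec7 !col_mx0.
Qed.

(** A principal isotropy would be conjugate into that of a generic plane, which
    fixes the vector r_0; then K would have a nonzero fixed vector. *)
Lemma diag_not_principal xi : stab_all_diag xi -> forall eta, orbit xi eta ->
  ~ principal eta.
Proof.
move=> K eta [P GP <-] /(_ _) pr.
(* the angle with cosine 3/5 and sine 4/5 gives a generic plane *)
have ab : (3 / 5) ^+ 2 + (4 / 5) ^+ 2 = 1 :> R by field.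
have [zeta Mzeta] := exists_model_point ab.
have [g Gg gP] := pr zeta.
have gen := generic_rational.
have PU := G2_unit GP; have gU := G2_unit Gg.
pose w := invmx P *m (invmx g *m e7 3).
suff w0 : w = 0.
  have : e7 3 = g *m (P *m w) :> 'cV[R]_7 by rewrite !mulKVmx.
  rewrite w0 !mulmx0 => /matrixP/(_ (o7 3) 0); rewrite !mxE !eqxx => /eqP.
  by rewrite oner_eq0.
apply: diag_no_fixed_vector => Q QQ; set k := diag7 _ _ _.
have /gP /(generic_stab gen Mzeta)[A [_ _ e]] : stab (act P xi) (P *m k *m invmx P).
  apply/(stabiliser_act _ _ GP); rewrite !mulmxA mulVmx // mul1mx -mulmxA mulVmx //.
  by rewrite mulmx1; exact: K.
have fix3 : diag7 A 1 A *m e7 3 = e7 3.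
  rewrite (_ : e7 3 = vec7 0 1%:M 0) ?diag7_vec7 ?mulmx0 ?scale1r //.
  have [[E0 E1 E2] [E3 E4 E5 E6]] := vec7E (0 : 'cV[R]_3) 0 1%:M 0.
  apply: eq_col7; apply: ord7P; rewrite ?(E0, E1, E2, E3, E4, E5, E6) !mxE -?val_eqE /= ?inordK //.
move: fix3; rewrite -e -!mulmxA => /(congr1 (mulmx (invmx g))); rewrite mulKmx //.
by move=> /(congr1 (mulmx (invmx P))); rewrite mulKmx.
Qed.

End Classification.

(** * Planes fixed by the coassociative isotropy *)

Section CoassociativeInvariant.
Context {R : realType}.
Implicit Types (z : 'cV[R]_4) (xi eta : @Gr R 7 4).

Notation act := (@Gr_act R 7 4).
Notation stab := (stabiliser (@G2 R) act).
Notation orbit := (orbit_of (@G2 R) act).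

(** The matrices of left multiplication by the quaternions 1, i, j, k. *)
Definition quat_table : seq (seq (seq R)) :=
  [:: [:: [:: 1; 0; 0; 0]; [:: 0; 1; 0; 0]; [:: 0; 0; 1; 0]; [:: 0; 0; 0; 1]];
      [:: [:: 0; -1; 0; 0]; [:: 1; 0; 0; 0]; [:: 0; 0; 0; -1]; [:: 0; 0; 1; 0]];
      [:: [:: 0; 0; -1; 0]; [:: 0; 0; 0; 1]; [:: 1; 0; 0; 0]; [:: 0; -1; 0; 0]];
      [:: [:: 0; 0; 0; -1]; [:: 0; 0; -1; 0]; [:: 0; 1; 0; 0]; [:: 1; 0; 0; 0]]].

Definition quat (l : nat) : 'M[R]_4 :=
  \matrix_(i, j) (nth [::] (nth [::] quat_table l) i)`_j.

Lemma quat_SO l : (l < 4)%N -> (quat l)^T *m quat l = 1%:M /\ \det (quat l) = 1.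
Proof.
case: l => [|[|[|[|//]]]] _.
all: split; last by rewrite det4 !mxE !inordK //=; ring.
all: apply/matrixP; apply: ord4P; apply: ord4P; rewrite !mxE sum4 !mxE.
all: by rewrite !inordK //= -val_eqE /= !inordK //=; ring.
Qed.

Lemma quat_mulE l z i : (i < 4)%N -> (quat l *m z) (o4 i) 0 =
  let s := nth [::] (nth [::] quat_table l) i in
  s`_0 * z (o4 0) 0 + s`_1 * z (o4 1) 0 + s`_2 * z (o4 2) 0 + s`_3 * z (o4 3) 0.
Proof. by move=> i4; rewrite mxE sum4 !mxE !inordK. Qed.

(** The images of a vector under the quaternion units are orthogonal, of the same
    length as the vector. *)
Lemma quat_span z z' : \sum_(l < 4) (z'^T *m (quat l *m z)) 0 0 *: (quat l *m z)
  = (z^T *m z) 0 0 *: z'.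
Proof.
have dE (x y : 'cV[R]_4) : (x^T *m y) 0 0 = x (o4 0) 0 * y (o4 0) 0
    + x (o4 1) 0 * y (o4 1) 0 + x (o4 2) 0 * y (o4 2) 0 + x (o4 3) 0 * y (o4 3) 0.
  by rewrite mxE sum4 !mxE.
have zE (k : R) (x : 'cV[R]_4) i : (k *: x) i 0 = k * x i 0 by rewrite mxE.
apply/matrixP => i j; rewrite (ord1 j) summxE sum4 !zE !dE; move: i.
by apply: ord4P; rewrite !quat_mulE // !inordK //=; ring.
Qed.

(** Two four-planes of R^7 share a nonzero vector. Its images under the unit
    quaternions, which lie in the isotropy SO(4), span the coassociative plane, so a
    plane stable under this isotropy contains it. *)
Lemma coassoc_only_invariant xi eta : normal_frame (model 1 0) xi ->
  (forall g, stab xi g -> stab eta g) -> eta = xi.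
Proof.
move=> Mxi inv; have [_ xiE] := Mxi.
have mem_xi z : wvec z \in val xi.
  rewrite xiE mem_perp model10 (tr_col_mx (0 : 'M[R]_(4, 3)) 1%:M).
  by rewrite (mul_row_col 0^T 1%:M^T z 0) trmx0 mul0mx mulmx0 addr0.
have xi_wvec v : v \in val xi -> exists z, v = wvec z.
  rewrite xiE mem_perp model10 (tr_col_mx (0 : 'M[R]_(4, 3)) 1%:M).
  have <- := vsubmxK (v : 'cV[R]_(4 + 3)); set z := usubmx _; set y := dsubmx _.
  rewrite (mul_row_col 0^T 1%:M^T z y) trmx0 mul0mx add0r trmx1 mul1mx => /eqP ->.
  by exists z.
have dxi : \dim (val xi) = 4 := eqP (valP xi).
have deta : \dim (val eta) = 4 := eqP (valP eta).
have [v v0 /andP[vxi veta]] : exists2 v, v != 0 & (v \in val xi) && (v \in val eta).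
  have := dimv_sum_cap (val xi) (val eta); rewrite dxi deta => d8.
  have d7 : (\dim (val xi + val eta) <= 7)%N by rewrite -[leqRHS](@dim_cV R 7) dimvS ?subvf.
  have cap0 : (val xi :&: val eta != 0)%VS.
    by rewrite -dimv_eq0; apply/eqP => d0; move: d8 d7; rewrite d0 addn0 => ->.
  exists (vpick (val xi :&: val eta)%VS); first by rewrite vpick0.
  by rewrite -memv_cap memv_pick.
have [z vE] := xi_wvec _ vxi.
have z0 : (z^T *m z) 0 0 != 0.
  rewrite -dotp_wvec -vE; apply: contra v0 => /eqP /dotp_eq0 ->; exact: eqxx.
have eta_quat l : (l < 4)%N -> wvec (quat l *m z) \in val eta.
  move=> l4; have [QQ dQ] := quat_SO l4.
  have [D gE] := coassoc_mx_wblock QQ dQ; have Gg := coassoc_mx_G2 QQ dQ.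
  have [_ <-] : stab eta (wblock (quat l) D).
    apply: inv; apply/(coassoc_stabiliser _ Mxi); rewrite -gE; split=> //.
    by exists (quat l), D.
  rewrite Gr_actE; last by rewrite -gE; exact: G2_unit.
  apply/memv_imgP; exists v => //.
  by rewrite lfunE /= vE wblock_wvec.
have wD (x y : 'cV[R]_4) : wvec (x + y) = wvec x + wvec y.
  by rewrite [RHS](add_col_mx x 0 y 0) addr0.
have wZ (s : R) (x : 'cV[R]_4) : wvec (s *: x) = s *: wvec x.
  by rewrite [RHS](scale_col_mx s x 0) scaler0.
have eta_w z' : wvec z' \in val eta.
  have -> : wvec z' = ((z^T *m z) 0 0)^-1 *: wvec ((z^T *m z) 0 0 *: z').
    by rewrite wZ scalerA mulVf // scale1r.
  rewrite memvZ // -quat_span !big_ord_recl big_ord0 addr0 !wD !wZ.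
  by rewrite !memvD // memvZ // eta_quat.
apply: val_inj; apply/eqP; rewrite eq_sym eqEdim dxi deta leqnn andbT.
by apply/subvP => u /xi_wvec[z' ->].
Qed.

End CoassociativeInvariant.

Theorem proposition1p5 (R : realType) :
  let act := @Gr_act R 7 4 in
  [/\ principal_orbits (@G2 R) act !=set0,
      (forall O, principal_orbits G2 act O -> Gr_submanifold_codim 1 O),
      (forall O, principal_orbits G2 act O ->
        forall xi, O xi -> lie_group_iso (stabiliser G2 act xi) (@SO R 3))
    & exists O1 O2 : set (@Gr R 7 4),
        [/\ O1 <> O2,
            special_orbits G2 act = [set O1; O2],
            ~ G_space_equiv G2 act act O1 O2,
            (forall xi, O1 xi ->
              lie_group_iso (stabiliser G2 act xi) (@SO R 4))
          & (forall xi, O2 xi ->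
              lie_group_iso (stabiliser G2 act xi)
                (mxgroup_prod (@SO R 3) (@Z2 R)))]].
Proof.
move=> act.
have [|x1 M1] := @exists_model_point R 1 0; first by ring.
have [|x2 M2] := @exists_model_point R 0 1; first by ring.
have notpr1 eta : orbit_of (@G2 R) act x1 eta -> ~ principal_point (@G2 R) act eta.
  exact/diag_not_principal/coassoc_stab_diag.
have notpr2 eta : orbit_of (@G2 R) act x2 eta -> ~ principal_point (@G2 R) act eta.
  exact/diag_not_principal/null_stab_diag.
have prP O : principal_orbits (@G2 R) act O -> exists a b eta, [/\ a ^+ 2 + b ^+ 2 = 1,
    generic a b, normal_frame (model a b) eta & O = orbit_of (@G2 R) act eta].
  move=> [xi pr <-]; have [[eta Meta o]|[eta Meta o]|[a [b [eta [ab gen Meta o]]]]] := model_trichotomy xi.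
  - by have := diag_not_principal (coassoc_stab_diag Meta) o pr.
  - by have := diag_not_principal (null_stab_diag Meta) o pr.
  - by exists a, b, eta; split=> //; exact: orbit_eq.
have x12 : ~ orbit_of (@G2 R) act x2 x1.
  move=> [g Gg e]; have : exists2 g, G2 g & act g x2 = x1 by exists g.
  by move=> /(same_orbitP M1 M2); rewrite !phi3_model; clear=> h; lra.
split.
- have ab : (3 / 5) ^+ 2 + (4 / 5) ^+ 2 = 1 :> R by field.
  have [xi Mxi] := exists_model_point ab.
  exists (orbit_of (@G2 R) act xi), xi => //.
  exact: (generic_principal generic_rational Mxi (orbit_refl xi)).
- move=> O /prP[a [b [eta [ab gen Meta ->]]]].
  exact: orbit_codim1 ab gen Meta.
- move=> O /prP[a [b [eta [_ gen Meta ->]]]] xi [P GP <-].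
  exact: generic_isotropy gen Meta GP.
exists (orbit_of (@G2 R) act x1), (orbit_of (@G2 R) act x2); split.
- by move=> e; apply: x12; rewrite -e; exact: orbit_refl.
- apply/seteqP; split=> O.
    move=> [[xi _ <-] notpr].
    have [[eta Meta o]|[eta Meta o]|[a [b [eta [ab gen Meta o]]]]] := model_trichotomy xi.
    + by left; rewrite (orbit_eq o) (normal_frame_inj Meta M1).
    + by right; rewrite (orbit_eq o) (normal_frame_inj Meta M2).
    + by exfalso; apply: notpr; exists xi => //; exact: (generic_principal gen Meta o).
  have special x : (forall eta, orbit_of (@G2 R) act x eta -> ~ principal_point (@G2 R) act eta) ->
      special_orbits (@G2 R) act (orbit_of (@G2 R) act x).
    move=> np; split; first by exists x.
    by move=> [xi pr e]; apply: (np xi) pr; rewrite -e; exact: orbit_refl.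
  by case=> ->; exact: special.
- move=> [f [f' [fO _ _ _ fg]]].
  have [inO2 _] := fO x1 (orbit_refl x1).
  (* equivariance makes f x1 stable under the isotropy of x1 *)
  have fx1 : f x1 = x1.
    apply: (coassoc_only_invariant M1) => g [Gg gx]; split=> //.
    have e : f (act g x1) = act g (f x1) by apply: fg Gg _; exact: orbit_refl.
    by rewrite -[LHS]e [act g x1]gx.
  by apply: x12; rewrite fx1 in inO2.
- by move=> xi [P GP <-]; exact: coassoc_isotropy M1 GP.
- by move=> xi [P GP <-]; exact: null_isotropy M2 GP.
Qed.
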